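(* Let $\mathcal{C}$ be a type I self-dual Weyl tensor and let $\Psi_0,\dots,\Psi_4$ be its components in a non transverse null frame $\{l,k,m,\bar m\}$ with associated null bivector base $\{\mathbf{W},\mathbf{U},\mathbf{V}\}$. Put $$I = \Psi_0\Psi_4-4\Psi_1\Psi_3+3\Psi_2^2,\qquad J=\begin{vmatrix}\Psi_4&\Psi_3&\Psi_2\\ \Psi_3&\Psi_2&\Psi_1\\ \Psi_2&\Psi_1&\Psi_0\end{vmatrix},\qquad \beta=\sqrt[3]{J+\sqrt{J^2-I^3/27}},$$ where $\beta$ is a particular non-zero value of this root, $$\alpha_1=\beta+\frac{I}{3\beta},\qquad \alpha_2=-\tfrac12\Big((1-\mathrm{i}\sqrt3)\beta+(1+\mathrm{i}\sqrt3)\frac{I}{3\beta}\Big),\qquad \alpha_3=-\tfrac12\Big((1+\mathrm{i}\sqrt3)\beta+(1-\mathrm{i}\sqrt3)\frac{I}{3\beta}\Big),$$ and, for $i=1,2,3$, $$A_i=\Psi_0\Psi_4+\Psi_2^2-2\Psi_1\Psi_3+\alpha_i\Psi_2+(\alpha_i^2-I),\qquad B_i=\Psi_1\Psi_4-\Psi_2\Psi_3+\Psi_3\alpha_i,$$ $$C_i=2\Psi_2\Psi_4-2\Psi_3^2+\alpha_i\Psi_4,\qquad D_i=\tfrac12(I-3\alpha_i^2).$$ Let $$\mathbf{W}_i=\frac{1}{\sqrt{D_iC_i}}\big(A_i\mathbf{U}+B_i\mathbf{W}+C_i\mathbf{V}\big),\qquad i=1,2,3,$$ with the signs of the square roots chosen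 so that $\{\mathbf{W}_1,\mathbf{W}_2,\mathbf{W}_3\}$ is oriented, and let $$b=\sum_{i=1}^3\frac{|C_i|}{|D_i|},\qquad c=-\sum_{i=1}^3\frac{\bar B_iC_i}{|D_i||C_i|},\qquad a=2+\frac{c\bar c}{b}.$$ Then the orthonormal Weyl canonical frame $\{e_0,e_1,e_2,e_3\}$ can be obtained as $$e_0=\frac{1}{2\sqrt b}\,(a\,l+b\,k+c\,m+\bar c\,\bar m),\qquad e_i=\sqrt2\,\mathbf{W}_i(e_0),\quad i=1,2,3.$$
   Context: Everything is pointwise on an oriented, time-oriented 4-dimensional spacetime with metric $g$ of signature $(-+++)$ and volume element $\eta$. Vectors and 1-forms are identified by $g$, and for a 2-form $X$ and a vector $y$, $X(y)_\alpha=X_{\alpha\beta}y^\beta$. Self-dual 2-forms. $X$ is self-dual if $*X=\mathrm{i}X$, $*$ the Hodge dual. On the 3-dimensional complex space of self-dual 2-forms use the metric $(X,Y)=\frac12X_{\alpha\beta}Y^{\alpha\beta}$, i.e. the metric $\mathcal{G}=\frac12(G-\mathrm{i}\eta)$, $G$ being the usual metric on 2-forms. A unitary self-dual 2-form satisfies $(X,X)=-1$. The product of 2-forms is $(A\times B)_{\alpha\beta}=A_\alpha{}^{\lambda}B_{\lambda\beta}$, and $a\wedge b=a\otimes b-b\otimes a$. Weyl tensor. The self-dual Weyl tensor is $\mathcal{C}=\frac12(C-\mathrm{i}*C)$, $C$ the Weyl tensor, regarded as a trace-free, $(\cdot,\cdot)$-symmetric endomorphism of the space of self-dual 2-forms;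 $(A\otimes B)(X)=A\,(B,X)$. Its characteristic equation is $x^3-Ix-2J=0$ with $I=\frac12\operatorname{tr}\mathcal{C}^2$, $J=\frac16\operatorname{tr}\mathcal{C}^3$. Type I means that the three roots $\alpha_1,\alpha_2,\alpha_3$ are distinct, equivalently $27J^2\neq I^3$. Then there are unitary, mutually orthogonal eigenvectors $\mathbf{W}_i$, $\mathcal{C}(\mathbf{W}_i)=\alpha_i\mathbf{W}_i$, called principal 2-forms, unique up to sign, with $\mathcal{C}=-\sum_i\alpha_i\mathbf{W}_i\otimes\mathbf{W}_i$. The eigenframe $\{\mathbf{W}_i\}$ is oriented if $\mathbf{W}_3=\mathrm{i}\sqrt2\,\mathbf{W}_1\times\mathbf{W}_2$. Null frames and components. A null frame (null tetrad) $\{l,k,m,\bar m\}$ has $l,k$ real future-pointing null vectors, $m$ complex null, $l\cdot k=-1$, $m\cdot\bar m=1$, other products zero. Its associated null bivector base is $\mathbf{W}=\frac1{\sqrt2}(l\wedge k+m\wedge\bar m)$, $\mathbf{U}=-\frac1{\sqrt2}l\wedge\bar m$, $\mathbf{V}=\frac1{\sqrt2}k\wedge m$, the tetrad being oriented so that these are self-dual (so $(\mathbf{W},\mathbf{W})=-1$, $(\mathbf{U},\mathbf{V})=\frac12$, other products zero). The components $\Psi_a$ are defined by $$\tfrac12\mathcal{C}=\Psi_0\mathbf{U}\otimes\mathbf{U}+\Psi_1\mathbf{U}\tilde\otimes\mathbf{W}+\Psi_2(\mathbf{U}\tilde\otimes\mathbf{V}+\mathbf{W}\otimes\mathbf{W})+\Psi_3\mathbf{W}\tilde\otimes\mathbf{V}+\Psi_4\mathbf{V}\otimes\mathbf{V},$$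 with $A\tilde\otimes B=A\otimes B+B\otimes A$. The frame is transverse if $\Psi_1=\Psi_3=0$, and non transverse otherwise. Weyl canonical frame. The three principal 2-forms determine six principal 2-planes (a time-like one and its orthogonal space-like one for each $\mathbf{W}_i$), which cut in four mutually orthogonal directions, one time-like and three space-like. The Weyl canonical frame corresponding to an oriented eigenframe $\{\mathbf{W}_i\}$ is the orthonormal frame $\{e_0,e_1,e_2,e_3\}$ along these directions, $e_0$ time-like and future-pointing, such that $\mathbf{W}_i=\frac1{\sqrt2}\big(e_0\wedge e_i-\mathrm{i}*(e_0\wedge e_i)\big)$ for $i=1,2,3$. (The roman $\mathrm{i}$ is the imaginary unit; the italic subscript $i$ is an index.)
   Formalization: The formal theorem asserts that an oriented sign choice exists only when all C_i are non-zero: a non transverse type I frame can have some C_i = 0 (e.g. Ψ0=-4, Ψ1=-2, Ψ2=0, Ψ3=Ψ4=1), where the formulas for W_i and c read 0/0. *)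

(* Defs.v *)
(* R[i] is the field of complex numbers over R. *)
From HB Require Import structures.
From mathcomp Require Import all_boot all_order all_algebra.
From mathcomp Require Import complex.

Set Implicit Arguments.
Unset Strict Implicit.
Unset Printing Implicit Defensive.

Import Order.TTheory GRing.Theory Num.Theory.
Local Open Scope complex_scope.
Local Open Scope ring_scope.

Definition minkowski (R : rcfType) : 'M[R]_4 :=
  diag_mx (\row_(j < 4) if j == ord0 then -1 else 1).

(* The tangent space at a point, in an arbitrary coordinate basis. The metric
   is the matrix g_{ab}; [positive_basis] tells whether the coordinate basis is
   positively oriented; [time_arrow] is a time-like vector declared
   future-pointing. *)
Record spacetime_point (R : rcfType) := SpacetimePoint {
  metric : 'M[R]_4;
  positive_basis : bool;
  time_arrow : 'cV[R]_4;
  metric_signature :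
    exists2 P : 'M[R]_4, P \in unitmx & P^T *m metric *m P = minkowski R;
  time_arrow_timelike : (time_arrow^T *m metric *m time_arrow) 0 0 < 0
}.

Definition tensor4 (F : Type) := 'I_4 -> 'I_4 -> 'I_4 -> 'I_4 -> F.

Definition levi_civita (F : comNzRingType) : tensor4 F := fun a b c d =>
  \det (\matrix_(i < 4, j < 4) (tnth [tuple a; b; c; d] i == j)%:R).

Definition ix1 : 'I_3 := @Ordinal 3 0 isT.
Definition ix2 : 'I_3 := @Ordinal 3 1 isT.
Definition ix3 : 'I_3 := @Ordinal 3 2 isT.

Section Pointwise.

Variables (R : rcfType) (M : spacetime_point R).
Local Notation C := R[i].
Local Notation toC := (map_mx (real_complex R)).

Definition dot (u v : 'cV[R]_4) : R := (u^T *m metric M *m v) 0 0.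

Definition future (v : 'cV[R]_4) : Prop :=
  dot v v <= 0 /\ dot v (time_arrow M) < 0.

Definition cmetric : 'M[C]_4 := toC (metric M).
Definition cinvmetric : 'M[C]_4 := toC (invmx (metric M)).

(* The complex bilinear (not sesquilinear) extension of the metric. *)
Definition cdot (u v : 'cV[C]_4) : C := (u^T *m cmetric *m v) 0 0.

(* eta_{abcd}, with eta positive on positively oriented bases. *)
Definition volume : tensor4 C := fun a b c d =>
  ((if positive_basis M then 1 else -1) * Num.sqrt (- \det (metric M)))%:C
  * levi_civita C a b c d.

(* A 2-form is the antisymmetric matrix of its covariant components X_{ab};
   [raise X] has the components X^{ab}. *)
Definition raise (X : 'M[C]_4) : 'M[C]_4 := cinvmetric *m X *m cinvmetric.

(* (X,Y) = (1/2) X_{ab} Y^{ab} *)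
Definition form_dot (X Y : 'M[C]_4) : C :=
  2^-1 * \sum_(a < 4) \sum_(b < 4) X a b * raise Y a b.

(* ( *X )_{ab} = (1/2) eta_{abcd} X^{cd} *)
Definition hodge (X : 'M[C]_4) : 'M[C]_4 := \matrix_(a, b)
  (2^-1 * \sum_(c < 4) \sum_(d < 4) volume a b c d * raise X c d).

Definition self_dual (X : 'M[C]_4) : Prop :=
  X^T = - X /\ hodge X = 'i *: X.

(* (A x B)_{ab} = A_a^c B_{cb} *)
Definition form_mul (A B : 'M[C]_4) : 'M[C]_4 := A *m cinvmetric *m B.

(* The 2-form associated by the metric with the bivector u wedge v. *)
Definition wedge (u v : 'cV[C]_4) : 'M[C]_4 :=
  let u' := cmetric *m u in let v' := cmetric *m v in
  u' *m v'^T - v' *m u'^T.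

(* X(y), as a vector: g^{ac} X_{cb} y^b. *)
Definition form_app (X : 'M[C]_4) (y : 'cV[C]_4) : 'cV[C]_4 :=
  cinvmetric *m X *m y.

Definition weyl_tensor (T : tensor4 R) : Prop :=
  [/\ forall a b c d, T b a c d = - T a b c d,
      forall a b c d, T c d a b = T a b c d,
      forall a b c d, T a b c d + T a c d b + T a d b c = 0
    & forall b d, \sum_(a < 4) \sum_(c < 4) invmx (metric M) a c * T a b c d = 0].

(* (1/2) (T - i *T), where * acts on the first pair of indices. *)
Definition self_dual_weyl (T : tensor4 R) : tensor4 C := fun a b c d =>
  2^-1 * ((T a b c d)%:C
          - 'i * hodge (\matrix_(p, q) (T p q c d)%:C) a b).

(* The endomorphism of the space of 2-forms defined by a double 2-form:
   S(X)_{ab} = (1/2) S_{abcd} X^{cd}; thus (A otimes B)(X) = A (B,X). *)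
Definition tensor_app (S : tensor4 C) (X : 'M[C]_4) : 'M[C]_4 :=
  \matrix_(a, b) form_dot (\matrix_(c, d) S a b c d) X.

Definition self_dual_basis (E : 3.-tuple 'M[C]_4) : Prop :=
  free E /\ forall X, self_dual X <-> X \in <<E>>%VS.

Definition matrix_in (E : 3.-tuple 'M[C]_4) (f : 'M[C]_4 -> 'M[C]_4)
    (N : 'M[C]_3) : Prop :=
  forall j, f (tnth E j) = \sum_(i < 3) N i j *: tnth E i.

(* The three roots of the characteristic equation of S, as an endomorphism of
   the space of self-dual 2-forms, are distinct. *)
Definition type_I (S : tensor4 C) : Prop :=
  exists (E : 3.-tuple 'M[C]_4) (N : 'M[C]_3) (x : 'I_3 -> C),
    [/\ self_dual_basis E, matrix_in E (tensor_app S) N,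
        char_poly N = \prod_(i < 3) ('X - (x i)%:P) & injective x].

Definition frame_W (l k : 'cV[R]_4) (m : 'cV[C]_4) : 'M[C]_4 :=
  (sqrtC 2)^-1 *: (wedge (toC l) (toC k) + wedge m (map_mx Num.conj m)).
Definition frame_U (l : 'cV[R]_4) (m : 'cV[C]_4) : 'M[C]_4 :=
  - ((sqrtC 2)^-1 *: wedge (toC l) (map_mx Num.conj m)).
Definition frame_V (k : 'cV[R]_4) (m : 'cV[C]_4) : 'M[C]_4 :=
  (sqrtC 2)^-1 *: wedge (toC k) m.

Definition null_frame (l k : 'cV[R]_4) (m : 'cV[C]_4) : Prop :=
  [/\ future l /\ future k,
      [/\ dot l l = 0, dot k k = 0 & dot l k = -1],
      [/\ cdot m m = 0, cdot m (map_mx Num.conj m) = 1,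
          cdot (toC l) m = 0 & cdot (toC k) m = 0]
    & [/\ self_dual (frame_W l k m), self_dual (frame_U l m)
        & self_dual (frame_V k m)]].

Definition otimes (A B : 'M[C]_4) : tensor4 C := fun a b c d => A a b * B c d.
Definition sotimes (A B : 'M[C]_4) : tensor4 C := fun a b c d =>
  otimes A B a b c d + otimes B A a b c d.

Definition weyl_components (S : tensor4 C) (U W V : 'M[C]_4)
    (Psi0 Psi1 Psi2 Psi3 Psi4 : C) : Prop :=
  forall a b c d, 2^-1 * S a b c d =
    Psi0 * otimes U U a b c d + Psi1 * sotimes U W a b c d
    + Psi2 * (sotimes U V a b c d + otimes W W a b c d)
    + Psi3 * sotimes W V a b c d + Psi4 * otimes V V a b c d.

Definition principal_forms (S : tensor4 C) (x : 'I_3 -> C)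
    (W : 'I_3 -> 'M[C]_4) : Prop :=
  [/\ forall i, self_dual (W i),
      forall i, tensor_app S (W i) = x i *: W i
    & forall i j, form_dot (W i) (W j) = - (i == j)%:R].

Definition oriented (W : 'I_3 -> 'M[C]_4) : Prop :=
  W ix3 = ('i * sqrtC 2) *: form_mul (W ix1) (W ix2).

(* For X unitary and self-dual, Re X is proportional to u wedge v with (u, v)
   an orthonormal basis of the time-like principal plane of X, which is
   therefore the range of Re X. *)
Definition timelike_plane (X : 'M[C]_4) (v : 'cV[R]_4) : Prop :=
  exists y : 'cV[R]_4,
    v = invmx (metric M) *m map_mx (@complex.Re R) X *m y.

Definition spacelike_plane (X : 'M[C]_4) (v : 'cV[R]_4) : Prop :=
  forall u, timelike_plane X u -> dot u v = 0.

Definition weyl_canonical_frame (W : 'I_3 -> 'M[C]_4) (e : 'I_4 -> 'cV[R]_4) :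
    Prop :=
  [/\ forall p q, dot (e p) (e q) = minkowski R p q,
      future (e ord0),
      forall i, timelike_plane (W i) (e ord0),
      forall i j, if i == j then timelike_plane (W i) (e (lift ord0 j))
                  else spacelike_plane (W i) (e (lift ord0 j))
    & forall i, let F := wedge (toC (e ord0)) (toC (e (lift ord0 i))) in
        W i = (sqrtC 2)^-1 *: (F - 'i *: hodge F)].

End Pointwise.

Definition weyl_I (F : comNzRingType) (Psi0 Psi1 Psi2 Psi3 Psi4 : F) : F :=
  Psi0 * Psi4 - 4 * Psi1 * Psi3 + 3 * Psi2 ^+ 2.

Definition weyl_J (F : comNzRingType) (Psi0 Psi1 Psi2 Psi3 Psi4 : F) : F :=
  \det (\matrix_(i < 3, j < 3)
    nth 0 (nth [::] [:: [:: Psi4; Psi3; Psi2];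
                        [:: Psi3; Psi2; Psi1];
                        [:: Psi2; Psi1; Psi0]] i) j).

Definition weyl_root (F : numClosedFieldType) (I beta : F) (i : 'I_3) : F :=
  let s := 'i * sqrtC 3 in
  let t := I / (3 * beta) in
  nth 0 [:: beta + t;
            - (2^-1 * ((1 - s) * beta + (1 + s) * t));
            - (2^-1 * ((1 + s) * beta + (1 - s) * t))] i.

(* Main.v *)
Require Import Defs.
From HB Require Import structures.
From mathcomp Require Import all_boot all_order all_algebra.
From mathcomp Require Import complex reals ring.
From mathcomp Require boolp.

Set Implicit Arguments.
Unset Strict Implicit.
Unset Printing Implicit Defensive.

Import Order.TTheory GRing.Theory Num.Theory.
Local Open Scope complex_scope.
Local Open Scope ring_scope.

(** Raising an index turns self-dual 2-forms into operators on complex vectors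
    that satisfy the Pauli relations and commute with their complex conjugates.
    Hence, for an oriented orthonormal triad [W_i], the operator
    [K = 1 + 2 \sum_j W_j conj(W_j)] satisfies [W_i K = conj(W_i) K] and
    [K^2 = 4 K]. So [K] maps the real null vector [l] to a real vector [e] with
    all [W_i(e)] real; its null components are [(a, b, c, conj c)], and
    [a] is determined by [<K l, K l> = 4 <l, K l> = - 4 b]. With [e0] the
    normalised [e] and [e_i = sqrt 2 W_i(e0)], evaluation on this frame gives
    [W_i + conj(W_i) = sqrt 2 e0 /\ e_i], and the Hodge dual of [e0 /\ e_i]
    follows from the self-duality of [W_i].

    On the algebraic side, [A_i U + B_i W + C_i V] is the image of [U] under
    [(C - alpha_j)(C - alpha_k)], a multiple of the projector on the
    eigenspace of [alpha_i]; its square is [- D_i C_i] because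
    [(alpha_i - alpha_j)(alpha_i - alpha_k) = - 2 D_i]. *)

(** * Pauli relations *)

(** Suitable multiples of the Pauli matrices satisfy these relations. The indices in ['I_3] are
    integers modulo 3, so adding 1 permutes them cyclically. *)
Definition quaternionic (F : comNzRingType) (A : algType F) (h kappa : F)
    (w : 'I_3 -> A) : Prop :=
  forall i, [/\ w i * w i = h%:A, w i * w (i + 1) = kappa *: w (i + 1 + 1)
              & w (i + 1) * w i = - (kappa *: w (i + 1 + 1))].

Lemma sum_I3_cyclic (V : zmodType) (f : 'I_3 -> V) (i : 'I_3) :
  \sum_j f j = f i + f (i + 1) + f (i + 1 + 1).
Proof.
rewrite !big_ord_recr big_ord0 /= add0r.
have e0 : widen_ord (leqnSn 2) (widen_ord (leqnSn 1) ord_max) = 0 :> 'I_3.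
  exact: val_inj.
have e1 : widen_ord (leqnSn 2) (ord_max : 'I_2) = 1 :> 'I_3 by exact: val_inj.
have e2 : ord_max = 1 + 1 :> 'I_3 by exact: val_inj.
rewrite e0 e1 e2; case: i => [[|[|[|//]]] p] /=.
- by rewrite (_ : Ordinal p = 0) ?add0r //; exact: val_inj.
- rewrite (_ : Ordinal p = 1); last exact: val_inj.
  by rewrite (_ : 1 + 1 + 1 = 0 :> 'I_3) 1?[RHS]addrC ?addrA //; exact: val_inj.
- rewrite (_ : Ordinal p = 1 + 1); last exact: val_inj.
  rewrite (_ : 1 + 1 + 1 = 0 :> 'I_3); last exact: val_inj.
  by rewrite add0r addrC addrA addrAC [_ + f 0]addrC.
Qed.

Lemma I3_cycle3 (i : 'I_3) : i + 1 + 1 + 1 = i.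
Proof. by case: i => [[|[|[|//]]] p]; exact: val_inj. Qed.

Lemma quaternionic_prev (F : comNzRingType) (A : algType F) (h kappa : F)
    (w : 'I_3 -> A) i : quaternionic h kappa w ->
  w i * w (i + 1 + 1) = - (kappa *: w (i + 1)) /\
  w (i + 1 + 1) * w i = kappa *: w (i + 1).
Proof. by move=> /(_ (i + 1 + 1)) []; rewrite I3_cycle3. Qed.

Section Quaternionic.

Variables (F : fieldType) (A : algType F) (kappa : F).

(** When [w] and [- v] are commuting Pauli families with the same constant, this is four times the
    singlet projector: its image consists of the vectors on which each [w i] acts as [v i]. *)
Definition intertwiner (w v : 'I_3 -> A) : A := 1 + 2 *: \sum_j w j * v j.

Hypothesis two_neq0 : 2 != 0 :> F.

Section Intertwiner.

Variables w v : 'I_3 -> A.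
Hypotheses (qw : quaternionic 2^-1 kappa w) (qv : quaternionic 2^-1 (- kappa)
  v).
Hypothesis wv : forall i j, w i * v j = v j * w i.

(** In both products the term [j = i] exchanges [w i] and [v i]. The other two terms give the same
    mixed products, because the opposite constants [kappa] and [- kappa] compensate the exchange of
    indices. *)
Lemma intertwinerP i : w i * intertwiner w v = v i * intertwiner w v.
Proof.
rewrite /intertwiner !mulrDr !mulr1 -!scalerAr (sum_I3_cyclic _ i) !mulrDr.
have [a1 a2 _] := qw i; have [b1 b2 _] := qv i.
have [a3 _] := quaternionic_prev i qw; have [b3 _] := quaternionic_prev i qv.
rewrite !mulrA a1 a2 a3 -!wv -!mulrA b1 b2 b3.
rewrite !scalerDr mulNr !mulrN -!scalerAl -!scalerAr mul1r mulr1.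
rewrite !scaleNr !opprK !scalerA mulfV // !scale1r !scalerN.
by rewrite !addrA [v i + w i]addrC addrAC.
Qed.

(** By [intertwinerP], each [w j * v j] acts on the image as [w j * w j], that is as [2^-1]; the
    three terms contribute 3 and the unit 1. *)
Lemma intertwiner_sqr : intertwiner w v * intertwiner w v = 4 *: intertwiner w
  v.
Proof.
rewrite {1}/intertwiner mulrDl mul1r -scalerAl mulr_suml.
have wwE j : w j * v j * intertwiner w v = 2^-1 *: intertwiner w v.
  by rewrite -mulrA -intertwinerP mulrA; have [-> _ _] := qw j; rewrite
    -scalerAl mul1r.
under eq_bigr => j _ do rewrite wwE.
rewrite sumr_const card_ord scalerMnl scalerA mulrnAr mulfV //.
by rewrite -{1}[intertwiner w v]scale1r -scalerDl -[4]natr1 addrC.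
Qed.

End Intertwiner.

(** The single oriented product expresses [w (1 + 1)] through [w 0 * w 1]; the remaining products
    follow from the squares and anticommutation. *)
Lemma quaternionic_oriented (w : 'I_3 -> A) :
    kappa ^+ 2 = - 2^-1 ->
    (forall i, w i * w i = 2^-1%:A) ->
    (forall i j, i != j -> w j * w i = - (w i * w j)) ->
    w 0 * w 1 = kappa *: w (1 + 1) ->
  quaternionic 2^-1 kappa w.
Proof.
move=> kappa2 ww anti w01.
have kappa2V : - (2 * kappa) * kappa = 1.
  by rewrite mulNr -mulrA -expr2 kappa2 mulrN opprK mulfV.
have w2E : w (1 + 1) = - (2 * kappa) *: (w 0 * w 1).
  by rewrite w01 scalerA kappa2V scale1r.
have w10 : w 1 * w 0 = - (w 0 * w 1) by exact: anti.
have w12 : w 1 * w (1 + 1) = kappa *: w 0.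
  rewrite w2E -scalerAr mulrA w10 mulNr -mulrA ww -scalerAr mulr1 scalerN.
  by rewrite scaleNr opprK scalerA mulrAC mulfV // mul1r.
have w20 : w (1 + 1) * w 0 = kappa *: w 1.
  rewrite w2E -scalerAl -mulrA w10 mulrN mulrA ww -scalerAl mul1r scalerN.
  by rewrite scaleNr opprK scalerA mulrAC mulfV // mul1r.
case=> [[|[|[|//]]] p].
- rewrite (_ : Ordinal p = 0) ?add0r; last exact: val_inj.
  by rewrite w10 w01.
- rewrite (_ : Ordinal p = 1); last exact: val_inj.
  rewrite (_ : 1 + 1 + 1 = 0 :> 'I_3); last exact: val_inj.
  by rewrite w12 (anti 1 (1 + 1)) // w12.
- rewrite (_ : Ordinal p = 1 + 1); last exact: val_inj.
  rewrite (_ : 1 + 1 + 1 = 0 :> 'I_3); last exact: val_inj.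
  by rewrite add0r w20 (anti (1 + 1) 0) // w20.
Qed.

End Quaternionic.

(** * Two-forms as operators *)

(* [rise] and [biv] are sealed with this key: unification must not unfold the
   matrix products behind them. *)
Fact form_key : unit. Proof. exact: tt. Qed.

Section Forms.

Variables (R : rcfType) (M : spacetime_point R).
Local Notation C := R[i].
Local Notation toC := (map_mx (real_complex R)).
Local Notation conjm := (map_mx Num.conj).
Local Notation G := (cmetric M).
Local Notation Gi := (cinvmetric M).
Implicit Types (X Y : 'M[C]_4) (x y : 'cV[C]_4).

(** Symmetry is inherited from the diagonal matrix [minkowski R] through the congruence. *)
Lemma metric_sym : (metric M)^T = metric M.
Proof.
have [P Pu PE] := metric_signature M.
have PTu : P^T \in unitmx by rewrite unitmx_tr.
have -> : metric M = invmx P^T *m minkowski R *m invmx P.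
  by rewrite -PE !mulmxA mulVmx // mul1mx -mulmxA mulmxV ?mulmx1.
by rewrite !trmx_mul !trmx_inv trmxK tr_diag_mx mulmxA.
Qed.

Lemma metric_unit : metric M \in unitmx.
Proof.
have [P Pu PE] := metric_signature M.
have : minkowski R \in unitmx.
  rewrite unitmxE det_diag unitfE; apply/prodf_neq0 => i _; rewrite mxE.
  by case: ifP => _; rewrite ?oppr_eq0 oner_eq0.
by rewrite -PE !unitmx_mul => /andP[/andP[_ ->]].
Qed.

Lemma cmetric_sym : G^T = G.
Proof. by rewrite /cmetric map_trmx metric_sym. Qed.

Lemma mul_cinvmetric : Gi *m G = 1%:M.
Proof. by rewrite /cinvmetric -map_mxM mulVmx ?metric_unit // map_mx1. Qed.

Lemma mul_cmetric : G *m Gi = 1%:M.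
Proof. by rewrite /cinvmetric -map_mxM mulmxV ?metric_unit // map_mx1. Qed.

Lemma cinvmetric_sym : Gi^T = Gi.
Proof. by rewrite /cinvmetric map_trmx trmx_inv metric_sym. Qed.

Lemma conj_real (x : R) : (x%:C : C)^* = x%:C.
Proof. exact: conjc_real. Qed.

Lemma conj_toC m n (u : 'M[R]_(m, n)) : conjm (toC u) = toC u.
Proof. by apply/matrixP => i j; rewrite !mxE conj_real. Qed.

Lemma conjmK m n (u : 'M[C]_(m, n)) : conjm (conjm u) = u.
Proof. by apply/matrixP => i j; rewrite !mxE conjCK. Qed.

Lemma conjmZ m n (a : C) (u : 'M[C]_(m, n)) : conjm (a *: u) = a^* *: conjm u.
Proof. exact: map_mxZ. Qed.

Lemma conjm_comb m n (a b : C) (u v : 'M[C]_(m, n)) :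
  conjm (a *: u - b *: v) = a^* *: conjm u - b^* *: conjm v.
Proof. by rewrite map_mxB !conjmZ. Qed.

Lemma conj_fixed_toC m n (u : 'M[C]_(m, n)) :
  conjm u = u -> toC (map_mx (@complex.Re R) u) = u.
Proof.
move=> /matrixP ur; apply/matrixP => i j; rewrite !mxE RRe_real //.
by rewrite CrealE; have := ur i j; rewrite mxE => ->.
Qed.

Lemma cdotE x y : cdot M x y = (x^T *m G *m y) 0 0.
Proof. by []. Qed.

Lemma cdotC x y : cdot M x y = cdot M y x.
Proof.
rewrite /cdot -[in LHS](trmxK (x^T *m _ *m _)) [LHS]mxE.
by rewrite !trmx_mul cmetric_sym trmxK mulmxA.
Qed.

(** An invertible Gram matrix [P^T *m G *m P] forces the matrix [P] of columns [v j] to be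
    invertible, so the [v j] form a basis. *)
Lemma gram_ext n (X Y : 'M[C]_(n, 4)) (v : 'I_4 -> 'cV[C]_4) :
  \matrix_(i, j) cdot M (v i) (v j) \in unitmx ->
  (forall j, X *m v j = Y *m v j) -> X = Y.
Proof.
move=> Hu eXY; pose P : 'M[C]_4 := \matrix_(i, j) v j i 0.
have col_P j : col j P = v j by apply/colP => i; rewrite !mxE.
have colM (A : 'M[C]_(n, 4)) j : col j (A *m P) = A *m v j.
  by rewrite colE -mulmxA -colE col_P.
have XP : X *m P = Y *m P.
  apply/matrixP => i j; have /colP/(_ i) : col j (X *m P) = col j (Y *m P).
    by rewrite !colM.
  by rewrite !mxE.
suff Pu : P \in unitmx by rewrite -[X](mulmxK Pu) XP mulmxK.
suff HE : P^T *m G *m P = \matrix_(i, j) cdot M (v i) (v j).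
  by move: Hu; rewrite -HE !unitmx_mul => /andP[_ ->].
apply/matrixP => i j; rewrite [RHS]mxE cdotE -!col_P tr_col -row_mul colE.
by rewrite mulmxA -row_mul -colE 2![RHS]mxE.
Qed.

Lemma cdot_linear x : scalar (cdot M x).
Proof. by move=> a y z; rewrite /cdot mulmxDr -scalemxAr !mxE. Qed.
HB.instance Definition _ x :=
  GRing.isLinear.Build C 'cV[C]_4 C *%R (cdot M x) (cdot_linear x).

Lemma cdotDl x y z : cdot M (x + y) z = cdot M x z + cdot M y z.
Proof. by rewrite cdotC raddfD /= !(cdotC z). Qed.

Lemma cdotNr x y : cdot M x (- y) = - cdot M x y.
Proof. exact: raddfN. Qed.

Lemma cdotZr a x y : cdot M x (a *: y) = a * cdot M x y.
Proof. exact: linearZ. Qed.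

Lemma cdotZl a x y : cdot M (a *: x) y = a * cdot M x y.
Proof. by rewrite cdotC linearZ /= (cdotC y). Qed.

Lemma cdot_toC (u v : 'cV[R]_4) : cdot M (toC u) (toC v) = (dot M u v)%:C.
Proof. by rewrite /cdot /cmetric map_trmx -!map_mxM mxE. Qed.

Lemma cdot_conj x y : cdot M (conjm x) (conjm y) = (cdot M x y)^*.
Proof.
by rewrite /cdot -{1}(conj_toC (metric M) : conjm G = G) map_trmx -!map_mxM mxE.
Qed.

Definition rise : 'M[C]_4 -> 'M[C]_4 := locked_with form_key (mulmx Gi).

Lemma riseE X : rise X = Gi *m X.
Proof. by rewrite /rise unlock. Qed.

Lemma riseD X Y : rise (X + Y) = rise X + rise Y.
Proof. by rewrite !riseE mulmxDr. Qed.

Lemma riseN X : rise (- X) = - rise X.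
Proof. by rewrite !riseE mulmxN. Qed.

Lemma riseZ a X : rise (a *: X) = a *: rise X.
Proof. by rewrite !riseE -scalemxAr. Qed.

Lemma rise_inj : injective rise.
Proof. by move=> X Y /(congr1 (mulmx G)); rewrite !riseE !mulmxA mul_cmetric
  !mul1mx. Qed.

Lemma rise_comb a b c X1 X2 X3 X4 x y1 y2 y3 y4 :
  rise X1 *m x = y1 -> rise X2 *m x = y2 -> rise X3 *m x = y3 ->
  rise X4 *m x = y4 ->
  rise (- (a *: X1) + b *: (X2 + X3) + c *: X4) *m x =
  - (a *: y1) + b *: (y2 + y3) + c *: y4.
Proof.
move=> <- <- <- <-.
by rewrite !(riseD, riseN, riseZ) !mulmxDl mulNmx -!scalemxAl !mulmxDl.
Qed.

Lemma rise_conj X : rise (conjm X) = conjm (rise X).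
Proof. by rewrite !riseE map_mxM conj_toC. Qed.

Lemma rise_conj_app X x : rise (conjm X) *m conjm x = conjm (rise X *m x).
Proof. by rewrite rise_conj [RHS]map_mxM. Qed.

Lemma rise_form_mul X Y : rise (form_mul M X Y) = rise X *m rise Y.
Proof. by rewrite !riseE /form_mul !mulmxA. Qed.

(** A 2-form with one index raised is an infinitesimal Lorentz transformation. *)
Lemma rise_skew X x y : X^T = - X ->
  cdot M (rise X *m x) y = - cdot M x (rise X *m y).
Proof.
move=> Xa; rewrite !riseE /cdot !trmx_mul cinvmetric_sym Xa.
rewrite -!mulmxA [Gi *m (G *m _)]mulmxA [G *m (Gi *m _)]mulmxA.
by rewrite mul_cinvmetric mul_cmetric !mul1mx mulNmx mulmxN mxE.
Qed.

Lemma rise_wedge u v x :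
  rise (wedge M u v) *m x = cdot M v x *: u - cdot M u x *: v.
Proof.
have cE w z : (G *m w)^T *m z = (cdot M w z)%:M.
  by rewrite trmx_mul cmetric_sym [LHS]mx11_scalar /cdot.
rewrite riseE /wedge mulmxBr mulmxBl !mulmxA mul_cinvmetric !mul1mx.
by rewrite -!mulmxA !cE !mul_mx_scalar.
Qed.

Lemma form_dotE X Y : X^T = - X ->
  form_dot M X Y = - 2^-1 * \tr (rise X *m rise Y).
Proof.
move=> Xa; rewrite /form_dot /mxtrace mulNr -mulrN; congr (_ * _).
have -> : \sum_a (rise X *m rise Y) a a = \tr (X *m raise M Y).
  by rewrite -/(mxtrace _) !riseE /raise -!mulmxA mxtrace_mulC -!mulmxA.
rewrite exchange_big /= -sumrN; apply: eq_bigr => b _.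
rewrite mxE -sumrN; apply: eq_bigr => a _.
by have /matrixP/(_ b a) := Xa; rewrite !mxE => ->; rewrite mulNr.
Qed.

Lemma hodge_linear : linear (hodge M).
Proof.
move=> a X Y; apply/matrixP => p q; rewrite !mxE mulrCA -mulrDr.
congr (_ * _); rewrite mulr_sumr -big_split; apply: eq_bigr => c _ /=.
rewrite mulr_sumr -big_split; apply: eq_bigr => d _ /=.
by rewrite /raise mulmxDr mulmxDl -scalemxAr -scalemxAl !mxE mulrDr mulrCA.
Qed.
HB.instance Definition _ :=
  GRing.isLinear.Build C 'M[C]_4 'M[C]_4 _ (hodge M) hodge_linear.

Lemma levi_civita_conj a b c d :
  (levi_civita C a b c d)^* = levi_civita C a b c d.
Proof.
rewrite /levi_civita -det_map_mx; congr (\det _).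
by apply/matrixP => i j; rewrite !mxE rmorph_nat.
Qed.

Lemma volume_conj a b c d : (volume M a b c d)^* = volume M a b c d.
Proof. by rewrite /volume [LHS]rmorphM /= levi_civita_conj conj_real. Qed.

Lemma hodge_conj X : hodge M (conjm X) = conjm (hodge M X).
Proof.
apply/matrixP => p q; rewrite !mxE rmorphM fmorphV rmorph_nat; congr (_ * _).
rewrite rmorph_sum; apply: eq_bigr => c _ /=.
rewrite rmorph_sum; apply: eq_bigr => d _ /=.
rewrite [RHS]rmorphM /= volume_conj; congr (_ * _).
by rewrite /raise -(conj_toC (invmx (metric M)) : conjm Gi = Gi) -!map_mxM mxE
  conj_toC.
Qed.

Lemma self_dualD a X Y : self_dual M X -> self_dual M Y -> self_dual M (a *: X
  + Y).
Proof.
move=> [Xa Xd] [Ya Yd]; split.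
  by rewrite linearP /= Xa Ya scalerN -opprD.
by rewrite linearP /= Xd Yd scalerDr !scalerA mulrC.
Qed.

Lemma self_dualZ a X : self_dual M X -> self_dual M (a *: X).
Proof. by move=> [Xa Xd]; split; rewrite linearZ /= (Xa, Xd) ?scalerN //
  !scalerA mulrC. Qed.

(** The operator [hodge M] is real, so the conjugate of [X] is anti-self-dual: subtracting ['i]
    times the dual cancels it and doubles [X]. *)
Lemma self_dual_part X : self_dual M X ->
  (X + conjm X) - 'i *: hodge M (X + conjm X) = 2 *: X.
Proof.
move=> [_ Xd]; rewrite linearD /= hodge_conj Xd conjmZ conjCi scalerDr !scalerA.
rewrite mulrN -expr2 sqrCi opprK scaleN1r scale1r scaler_nat mulr2n.
by rewrite opprD opprK addrACA subrr addr0.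
Qed.

End Forms.

(** * Null tetrads *)

Local Ltac by_entries := by apply/colP => i; rewrite !mxE; ring.

(** The second table is the first with [m] and [mb] exchanged, as under complex conjugation.
    Unspecified matrices reduce the claim to ring identities. *)
Lemma tetrad_commute (F : comNzRingType) n (X Y : 'M[F]_n)
    (L K m mb : 'cV[F]_n) (a b c a' b' c' : F) :
  [/\ X *m L = c *: m - b *: L, X *m K = b *: K - a *: mb,
      X *m m = b *: m - a *: L & X *m mb = c *: K - b *: mb] ->
  [/\ Y *m L = c' *: mb - b' *: L, Y *m K = b' *: K - a' *: m,
      Y *m mb = b' *: mb - a' *: L & Y *m m = c' *: K - b' *: m] ->
  [/\ X *m (Y *m L) = Y *m (X *m L), X *m (Y *m K) = Y *m (X *m K),
      X *m (Y *m m) = Y *m (X *m m) & X *m (Y *m mb) = Y *m (X *m mb)].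
Proof.
move=> [eL eK em emb] [fL fK fmb fm]; split.
- by rewrite fL eL !mulmxBr -!scalemxAr emb eL fm fL; by_entries.
- by rewrite fK eK !mulmxBr -!scalemxAr em eK fmb fK; by_entries.
- by rewrite fm em !mulmxBr -!scalemxAr eK em fL fm; by_entries.
- by rewrite fmb emb !mulmxBr -!scalemxAr emb eL fmb fK; by_entries.
Qed.

Section NullTetrad.

Variables (R : rcfType) (M : spacetime_point R).
Local Notation C := R[i].
Local Notation conjm := (map_mx Num.conj).

(** Here [mb] is an independent vector, so that the algebra stays bilinear; it is tied to the
    conjugate of [m] only where conjugation enters. *)
Definition null_tetrad (L K m mb : 'cV[C]_4) : Prop :=
  [/\ [/\ cdot M L L = 0, cdot M K K = 0 & cdot M L K = -1],
      [/\ cdot M m m = 0, cdot M mb mb = 0 & cdot M m mb = 1]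
    & [/\ cdot M L m = 0, cdot M L mb = 0, cdot M K m = 0 & cdot M K mb = 0]].

Variables L K m mb : 'cV[C]_4.
Hypothesis nt : null_tetrad L K m mb.
Implicit Types a b c : C.

Lemma null_tetrad_cdot :
  ((cdot M L L = 0) * (cdot M L K = -1) * (cdot M L m = 0) * (cdot M L mb = 0)
  * (cdot M K L = -1) * (cdot M K K = 0) * (cdot M K m = 0) * (cdot M K mb = 0)
  * (cdot M m L = 0) * (cdot M m K = 0) * (cdot M m m = 0) * (cdot M m mb = 1)
  * (cdot M mb L = 0) * (cdot M mb K = 0) * (cdot M mb m = 1)
  * (cdot M mb mb = 0))%type.
Proof.
have [[ll kk lk] [mm bb mmb] [lm lmb km kmb]] := nt.
have kl : cdot M K L = -1 by rewrite cdotC.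
have ml : cdot M m L = 0 by rewrite cdotC.
have mbl : cdot M mb L = 0 by rewrite cdotC.
have mk : cdot M m K = 0 by rewrite cdotC.
have mbk : cdot M mb K = 0 by rewrite cdotC.
have bm : cdot M mb m = 1 by rewrite cdotC.
exact: (ll, lk, lm, lmb, kl, kk, km, kmb, ml, mk, mm, mmb, mbl, mbk, bm, bb).
Qed.

Lemma null_tetrad_ext n (X Y : 'M[C]_(n, 4)) :
  X *m L = Y *m L -> X *m K = Y *m K -> X *m m = Y *m m ->
  X *m mb = Y *m mb -> X = Y.
Proof.
move=> eL eK em emb; pose v (j : 'I_4) := tnth [tuple L; K; m; mb] j.
apply: (@gram_ext _ M n X Y v); last first.
  by case=> [[|[|[|[|//]]]] p]; rewrite /v !(tnth_nth 0) /=.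
(* The Gram matrix of a null tetrad is its own inverse. *)
pose H : 'M[C]_4 := \matrix_(i, j) cdot M (v i) (v j).
have HH : H *m H = 1%:M.
  apply/matrixP => i j; rewrite [LHS]mxE !big_ord_recr big_ord0 /= !mxE.
  case: i => [[|[|[|[|//]]]] p]; case: j => [[|[|[|[|//]]]] q];
    rewrite /v !(tnth_nth 0) /= !null_tetrad_cdot /=; ring.
by case: (mulmx1_unit HH).
Qed.

Lemma cdot_tetrad (p q r t p' q' r' t' : C) :
  cdot M (p *: L + q *: K + r *: m + t *: mb) (p' *: L + q' *: K + r' *: m + t'
    *: mb)
  = r * t' + t * r' - p * q' - q * p'.
Proof.
have E x : cdot M (p *: L + q *: K + r *: m + t *: mb) x =
  p * cdot M L x + q * cdot M K x + r * cdot M m x + t * cdot M mb x.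
  by rewrite !cdotDl !cdotZl.
have F x : cdot M x (p' *: L + q' *: K + r' *: m + t' *: mb) =
  p' * cdot M x L + q' * cdot M x K + r' * cdot M x m + t' * cdot M x mb.
  by rewrite cdotC !cdotDl !cdotZl !(cdotC _ _ x).
by rewrite E !F !null_tetrad_cdot; ring.
Qed.

(** The basis dual to [L], [K], [m], [mb] is [- K], [- L], [mb], [m]; nondegeneracy reduces the
    equality to products with the tetrad. *)
Lemma tetrad_expansion (x : 'cV[C]_4) :
  x = - cdot M K x *: L + - cdot M L x *: K + cdot M mb x *: m + cdot M m x *:
    mb.
Proof.
set y := (X in _ = X).
have cy z : cdot M y z = - cdot M K x * cdot M L z + - cdot M L x * cdot M K z
    + cdot M mb x * cdot M m z + cdot M m x * cdot M mb z.
  by rewrite /y !cdotDl !cdotZl.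
clearbody y; have cP u v : u^T *m cmetric M *m v = (cdot M u v)%:M.
  by rewrite [LHS]mx11_scalar cdotE.
suff e : x^T *m cmetric M = y^T *m cmetric M.
  apply: trmx_inj; move/(congr1 (mulmxr (cinvmetric M))): e.
  by rewrite /= -!mulmxA mul_cmetric !mulmx1.
apply: null_tetrad_ext; rewrite !cP; congr _%:M; rewrite cy !null_tetrad_cdot.
- by rewrite (cdotC _ x L); move: (cdot M L x) (cdot M K x) (cdot M m x) (cdot
  M mb x) => *; ring.
- by rewrite (cdotC _ x K); move: (cdot M L x) (cdot M K x) (cdot M m x) (cdot
  M mb x) => *; ring.
- by rewrite (cdotC _ x m); move: (cdot M L x) (cdot M K x) (cdot M m x) (cdot
  M mb x) => *; ring.
- by rewrite (cdotC _ x mb); move: (cdot M L x) (cdot M K x) (cdot M m x) (cdot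
  M mb x) => *; ring.
Qed.

(** When [mb] is the conjugate of [m], this is [sqrtC 2] times the combination of [U], [W], [V],
    which keeps square roots out of its action on the tetrad. *)
Definition biv0 a b c : 'M[C]_4 :=
  - (a *: wedge M L mb) + b *: (wedge M L K + wedge M m mb) + c *: wedge M K m.

Lemma biv0_frame a b c :
  [/\ rise M (biv0 a b c) *m L = c *: m - b *: L,
      rise M (biv0 a b c) *m K = b *: K - a *: mb,
      rise M (biv0 a b c) *m m = b *: m - a *: L
    & rise M (biv0 a b c) *m mb = c *: K - b *: mb].
Proof.
have E x := rise_comb a b c (rise_wedge M L mb x) (rise_wedge M L K x)
  (rise_wedge M m mb x) (rise_wedge M K m x).
by split; apply: etrans (E _) _; rewrite !null_tetrad_cdot; by_entries.
Qed.

Hypotheses (Lr : conjm L = L) (Kr : conjm K = K) (mE : conjm m = mb)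
  (mbE : conjm mb = m).

Local Opaque biv0.

Lemma conj_biv0_frame a b c :
  [/\ rise M (conjm (biv0 a b c)) *m L = c^* *: mb - b^* *: L,
      rise M (conjm (biv0 a b c)) *m K = b^* *: K - a^* *: m,
      rise M (conjm (biv0 a b c)) *m mb = b^* *: mb - a^* *: L
    & rise M (conjm (biv0 a b c)) *m m = c^* *: K - b^* *: m].
Proof.
have E x := rise_conj_app M (biv0 a b c) x.
have [eL eK em emb] := biv0_frame a b c.
split.
- rewrite -{1}Lr E eL conjm_comb Lr mE; reflexivity.
- rewrite -{1}Kr E eK conjm_comb Kr mbE; reflexivity.
- rewrite -{1}mE E em conjm_comb Lr mE; reflexivity.
- rewrite -{1}mbE E emb conjm_comb Kr mbE; reflexivity.
Qed.

(** The anticommutator of two such forms is a scalar and the commutator is a form of the same kind.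
    Both sides are compared on the tetrad. *)
Lemma rise_biv0_mul a b c a' b' c' :
  2 *: (rise M (biv0 a b c) *m rise M (biv0 a' b' c')) =
  (2 * b * b' - a * c' - c * a')%:M
  + rise M (biv0 (2 * (a * b' - b * a')) (a * c' - c * a') (2 * (b * c' - c *
    b'))).
Proof.
have [eL eK em emb] := biv0_frame a b c.
have [fL fK fm fmb] := biv0_frame a' b' c'.
have [gL gK gm gmb] := biv0_frame (2 * (a * b' - b * a')) (a * c' - c * a')
  (2 * (b * c' - c * b')).
move: (rise _ _) gL gK gm gmb => Z gL gK gm gmb.
move: (rise _ (biv0 a' _ _)) fL fK fm fmb => Y fL fK fm fmb.
move: (rise _ _) eL eK em emb => X eL eK em emb.
apply: null_tetrad_ext; rewrite mulmxDl -scalemxAl -mulmxA mul_scalar_mx.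
- by rewrite fL gL mulmxBr -!scalemxAr em eL; by_entries.
- by rewrite fK gK mulmxBr -!scalemxAr eK emb; by_entries.
- by rewrite fm gm mulmxBr -!scalemxAr em eL; by_entries.
- by rewrite fmb gmb mulmxBr -!scalemxAr eK emb; by_entries.
Qed.

(** Self-dual and anti-self-dual forms are the two commuting halves of the complexified Lorentz
    algebra. *)
Lemma rise_biv0_comm_conj a b c a' b' c' :
  rise M (biv0 a b c) *m rise M (conjm (biv0 a' b' c')) =
  rise M (conjm (biv0 a' b' c')) *m rise M (biv0 a b c).
Proof.
have [e1 e2 e3 e4] :=
  tetrad_commute (biv0_frame a b c) (conj_biv0_frame a' b' c').
by apply: null_tetrad_ext; rewrite -!mulmxA; [exact: e1|exact: e2|exact:
  e3|exact: e4].
Qed.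

End NullTetrad.

(** * Coordinates in the null bivector base *)

Section NullFrame.

Variables (R : rcfType) (M : spacetime_point R).
Variables (l k : 'cV[R]_4) (m : 'cV[R[i]]_4).
Hypothesis nf : null_frame M l k m.
Local Notation C := R[i].
Local Notation toC := (map_mx (real_complex R)).
Local Notation conjm := (map_mx Num.conj).
Local Notation L := (toC l).
Local Notation K := (toC k).
Local Notation mb := (conjm m).
Local Notation biv0 := (biv0 M L K m mb).
Implicit Types a b c : C.

Lemma null_frame_tetrad : null_tetrad M L K m mb.
Proof.
have [_ [ll kk lk] [mm mmb lm km] _] := nf.
have lmb : cdot M L mb = 0 by rewrite -(conj_toC l) cdot_conj lm conjC0.
have kmb : cdot M K mb = 0 by rewrite -(conj_toC k) cdot_conj km conjC0.
have bb : cdot M mb mb = 0 by rewrite cdot_conj mm conjC0.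
have LL : cdot M L L = 0 by rewrite cdot_toC ll.
have KK : cdot M K K = 0 by rewrite cdot_toC kk.
have LK : cdot M L K = -1 by rewrite cdot_toC lk rmorphN1.
by [].
Qed.

Let nt := null_frame_tetrad.

Definition biv a b c : 'M[C]_4 := locked_with form_key
  (a *: frame_U M l m + b *: frame_W M l k m + c *: frame_V M k m).

Lemma bivE a b c :
  biv a b c = a *: frame_U M l m + b *: frame_W M l k m + c *: frame_V M k m.
Proof. by rewrite /biv unlock. Qed.

Lemma bivD a b c a' b' c' :
  biv a b c + biv a' b' c' = biv (a + a') (b + b') (c + c').
Proof.
rewrite !bivE; move: (frame_U _ _ _) (frame_W _ _ _ _) (frame_V _ _ _).
by move=> X Y Z; rewrite addrACA (addrACA (a *: X)) -!scalerDl.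
Qed.

Lemma bivZ t a b c : t *: biv a b c = biv (t * a) (t * b) (t * c).
Proof.
rewrite !bivE; move: (frame_U _ _ _) (frame_W _ _ _ _) (frame_V _ _ _).
by move=> X Y Z; rewrite !scalerDr !scalerA.
Qed.

Lemma biv_eq0 : biv 0 0 0 = 0.
Proof. by rewrite bivE !scale0r !addr0. Qed.

Local Notation s := ((sqrtC 2)^-1 : C).

Lemma sqrtC2V_conj : s^* = s.
Proof.
by apply: conj_Creal; rewrite ger0_real // invr_ge0 sqrtC_ge0 ler0n.
Qed.

Lemma sqrtC2_neq0 : sqrtC 2 != 0 :> C.
Proof. by rewrite sqrtC_eq0 pnatr_eq0. Qed.

Lemma sqr_sqrtC2V : s * s = 2^-1.
Proof. by rewrite -invfM -expr2 sqrtCK. Qed.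

Lemma biv_scale a b c : biv a b c = s *: biv0 a b c.
Proof.
have E X1 X2 X3 X4 : a *: - (s *: X1) + b *: (s *: (X2 + X3)) + c *: (s *: X4) =
    s *: (- (a *: X1) + b *: (X2 + X3) + c *: X4) :> 'M[C]_4.
  rewrite [in RHS]scalerDr [X in _ = X + _]scalerDr !scalerN !scalerA.
  by rewrite (mulrC s a) (mulrC s b) (mulrC s c).
by rewrite bivE; exact: E.
Qed.

Lemma conj_biv a b c : conjm (biv a b c) = s *: conjm (biv0 a b c).
Proof. by rewrite biv_scale conjmZ sqrtC2V_conj. Qed.

Lemma biv_self_dual a b c : self_dual M (biv a b c).
Proof.
have [_ _ _ [sW sU sV]] := nf; rewrite bivE addrC.
exact (self_dualD c sV (self_dualD a sU (self_dualZ b sW))).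
Qed.

Lemma rise_biv_mul a b c a' b' c' :
  rise M (biv a b c) *m rise M (biv a' b' c') =
  (b * b' / 2 - (a * c' + c * a') / 4)%:M
  + (sqrtC 2 / 4) *: rise M
      (biv (2 * (a * b' - b * a')) (a * c' - c * a') (2 * (b * c' - c * b'))).
Proof.
rewrite !biv_scale !riseZ -scalemxAl -scalemxAr !scalerA sqr_sqrtC2V.
have -> : sqrtC 2 / 4 * s = 4^-1 :> C by rewrite mulrAC mulfV ?mul1r
  ?sqrtC2_neq0.
have -> : 2^-1 = 4^-1 * 2 :> C by field.
rewrite -scalerA (rise_biv0_mul nt) scalerDr; congr (_ + _).
by rewrite scale_scalar_mx; congr _%:M; field.
Qed.

Lemma rise_biv_comm_conj a b c a' b' c' :
  rise M (biv a b c) *m rise M (conjm (biv a' b' c')) =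
  rise M (conjm (biv a' b' c')) *m rise M (biv a b c).
Proof.
rewrite conj_biv biv_scale !riseZ -!scalemxAl -!scalemxAr.
by rewrite (rise_biv0_comm_conj nt (conj_toC l) (conj_toC k) erefl (conjmK m))
  scalerA mulrC -scalerA.
Qed.

(** The commutator parts cancel, leaving the Clifford relation for minus the metric on self-dual
    forms. *)
Lemma rise_biv_anticomm a b c a' b' c' :
  rise M (biv a b c) *m rise M (biv a' b' c')
  + rise M (biv a' b' c') *m rise M (biv a b c) =
  (b * b' - (a * c' + c * a') / 2)%:M.
Proof.
rewrite !rise_biv_mul addrACA -scalerDr -riseD bivD -raddfD /=.
have -> : 2 * (a * b' - b * a') + 2 * (a' * b - b' * a) = 0 by ring.
have -> : a * c' - c * a' + (a' * c - c' * a) = 0 by ring.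
have -> : 2 * (b * c' - c * b') + 2 * (b' * c - c' * b) = 0 by ring.
by rewrite biv_eq0 riseE mulmx0 scaler0 addr0; congr _%:M; field.
Qed.

(** The trace of a product is half that of the anticommutator, a scalar matrix of size 4. *)
Lemma form_dot_biv a b c a' b' c' :
  form_dot M (biv a b c) (biv a' b' c') = (a * c' + c * a') / 2 - b * b'.
Proof.
have [sk _] := biv_self_dual a b c; rewrite form_dotE //.
have : \tr (rise M (biv a b c) *m rise M (biv a' b' c')
    + rise M (biv a' b' c') *m rise M (biv a b c)) =
    2 * \tr (rise M (biv a b c) *m rise M (biv a' b' c')).
  by rewrite mxtraceD [X in _ + X]mxtrace_mulC mulr_natl mulr2n.
rewrite rise_biv_anticomm mxtrace_scalar => e.
apply: (mulfI (_ : 2 != 0)); first by rewrite pnatr_eq0.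
by rewrite mulrCA -e -mulr_natr; field.
Qed.

Lemma biv_inj a b c a' b' c' :
  biv a b c = biv a' b' c' -> [/\ a = a', b = b' & c = c'].
Proof.
move=> e; have t x y z : (a * z + c * x) / 2 - b * y = (a' * z + c' * x) / 2 -
  b' * y.
  by rewrite -!form_dot_biv e.
split.
(* Pairing with [2 V], [W] and [2 U] isolates the three coefficients in turn. *)
- have := t 0 0 2; rewrite !mulr0 !subr0 !addr0.
  by rewrite !mulfK ?pnatr_eq0.
- by have := t 0 1 0; rewrite !mulr0 !addr0 !mul0r !sub0r !mulr1 => /oppr_inj.
- have := t 2 0 0; rewrite !mulr0 !subr0 !add0r.
  by rewrite !mulfK ?pnatr_eq0.
Qed.

(** The factor here is the inverse of the ['i * sqrtC 2] in [oriented]; it is the constant [kappa]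
    of the Pauli relations. *)
Lemma oriented_biv (a b c : 'I_3 -> C) :
  oriented M (fun i => biv (a i) (b i) (c i)) <->
  rise M (biv (a 0) (b 0) (c 0)) *m rise M (biv (a 1) (b 1) (c 1)) =
    (- 'i / sqrtC 2) *: rise M (biv (a (1 + 1)) (b (1 + 1)) (c (1 + 1))).
Proof.
have iV : - 'i / sqrtC 2 * ('i * sqrtC 2) = 1 :> C.
  rewrite mulrACA mulVf ?sqrtC2_neq0 // mulr1 mulNr -expr2 sqrCi opprK //.
rewrite /oriented.
have -> : ix1 = 0 by exact: val_inj.
have -> : ix2 = 1 by exact: val_inj.
have -> : ix3 = 1 + 1 by exact: val_inj.
rewrite -rise_form_mul; split.
  by move=> ->; rewrite riseZ scalerA iV scale1r.
by move=> e; apply: (@rise_inj _ M); rewrite riseZ e scalerA mulrC iV scale1r.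
Qed.

End NullFrame.

(** * The canonical frame of an oriented triad *)

Section CanonicalFrame.

Variables (R : rcfType) (M : spacetime_point R).
Local Notation C := R[i].
Local Notation toC := (map_mx (real_complex R)).
Local Notation conjm := (map_mx Num.conj).
Variables (X : 'I_3 -> 'M[C]_4) (e0 : 'cV[R]_4).
Local Notation w i := (rise M (X i)).
Local Notation v i := (rise M (conjm (X i))).
Local Notation E0 := (toC e0).
Hypothesis Xsd : forall i, self_dual M (X i).
Hypothesis ww : forall i, w i *m w i = (2^-1)%:M.
Hypothesis anti : forall i j, i != j -> w i *m w j = - (w j *m w i).
Hypothesis comm : forall i j, w i *m v j = v j *m w i.
Hypothesis real_e0 : forall i, w i *m E0 = v i *m E0.
Hypothesis norm_e0 : dot M e0 e0 = -1.
Hypothesis future_e0 : future M e0.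

Local Notation y i := (sqrtC 2 *: (w i *m E0)).
Local Notation Z i := (rise M (X i + conjm (X i))).

Let sqr2 : sqrtC 2 * sqrtC 2 = 2 :> C.
Proof. by rewrite -expr2 sqrtCK. Qed.

Let s2C : (sqrtC 2 : C)^* = sqrtC 2.
Proof. by apply: conj_Creal; rewrite ger0_real // sqrtC_ge0 ler0n. Qed.

Let skewX i : (X i)^T = - X i. Proof. by case: (Xsd i). Qed.

Let skewZ i : (X i + conjm (X i))^T = - (X i + conjm (X i)).
Proof. by rewrite linearD /= map_trmx skewX map_mxN opprD. Qed.

Let wwx i (x : 'cV[C]_4) : w i *m (w i *m x) = 2^-1 *: x.
Proof. by rewrite mulmxA ww mul_scalar_mx. Qed.

Let cdot_e0 : cdot M E0 E0 = -1.
Proof. by rewrite cdot_toC norm_e0 rmorphN1. Qed.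

Let cdot_e0w i : cdot M E0 (w i *m E0) = 0.
Proof.
have := rise_skew M E0 E0 (skewX i); rewrite cdotC => /eqP.
by rewrite -subr_eq0 opprK -mulr2n mulrn_eq0 => /eqP.
Qed.

Let cdot_yE i j : cdot M (y i) (y j) = - 2 * cdot M E0 (w i *m (w j *m E0)).
Proof.
by rewrite cdotZl cdotZr mulrA sqr2 rise_skew // mulrN mulNr.
Qed.

(** For distinct indices the product is symmetric because the metric is, and antisymmetric because
    [w i] and [w j] anticommute. *)
Let cdot_y i j : cdot M (y i) (y j) = (i == j)%:R.
Proof.
rewrite cdot_yE; have [->|ij] := eqVneq i j.
  by rewrite wwx cdotZr cdot_e0 mulrN1 mulrNN mulfV ?pnatr_eq0.
have : cdot M (y i) (y j) = cdot M (y j) (y i) by rewrite cdotC.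
rewrite !cdot_yE mulmxA anti // mulNmx -mulmxA cdotNr.
move: (cdot M E0 (w j *m _)) => c e.
have : c * 4 = 0 by rewrite -[RHS](subrr (- 2 * c)) -{1}e; ring.
by move/eqP; rewrite mulf_eq0 pnatr_eq0 orbF => /eqP ->; rewrite oppr0 mulr0.
Qed.

Let conj_y i : conjm (y i) = y i.
Proof.
rewrite conjmZ s2C -rise_conj_app conj_toC.
by congr (_ *: _); symmetry; apply: real_e0.
Qed.

(** By [conj_y] each [y i] is real, so taking real parts only changes the field of scalars. *)
Definition canonical_frame (p : 'I_4) : 'cV[R]_4 :=
  if unlift ord0 p is Some i then map_mx (@complex.Re R) (y i) else e0.
Local Notation e := canonical_frame.

Let e_lift i : toC (e (lift ord0 i)) = y i.
Proof. by rewrite /canonical_frame liftK conj_fixed_toC. Qed.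

Let e_ord0 : e ord0 = e0.
Proof. by rewrite /canonical_frame unlift_none. Qed.

Let I4P (p : 'I_4) : p = ord0 \/ exists i, p = lift ord0 i.
Proof. by case: (unliftP ord0 p) => [i|] ->; [right; exists i | left]. Qed.

Lemma canonical_frame_dot p q : dot M (e p) (e q) = minkowski R p q.
Proof.
apply: (@complexI R); rewrite -cdot_toC.
have [->|[i ->]] := I4P p; have [->|[j ->]] := I4P q;
  rewrite ?e_ord0 ?e_lift /minkowski !mxE.
- by rewrite cdot_e0 rmorphN1.
- by rewrite cdotZr cdot_e0w mulr0 rmorph0.
- by rewrite cdotZl cdotC cdot_e0w mulr0 rmorph0.
- rewrite cdot_y (inj_eq (@lift_inj _ ord0)) /= !mulrb.
  by case: eqP => _; rewrite ?rmorph1 ?rmorph0.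
Qed.

Let Z_app i (x : 'cV[C]_4) : Z i *m x = w i *m x + v i *m x.
Proof. by rewrite riseD mulmxDl. Qed.

Let Z_e0 i : Z i *m E0 = sqrtC 2 *: y i.
Proof. by rewrite Z_app -real_e0 scalerA sqr2 scaler_nat mulr2n. Qed.

(** Once moved past [w j], the conjugate operator acts on [E0] as [w i], so the anticommutator of
    [w i] and [w j] appears. *)
Let Z_y i j : Z i *m y j = (i == j)%:R * sqrtC 2 *: E0.
Proof.
rewrite Z_app -!scalemxAr -scalerDr [v i *m _]mulmxA -comm -mulmxA -real_e0.
have [->|ij] := eqVneq i j.
  have half : 2^-1 + 2^-1 = 1 :> C by field.
  by rewrite wwx mul1r -scalerDl half scale1r.
by rewrite !mulmxA -mulmxDl (anti ij) addNr mul0mx scaler0 mul0r scale0r.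
Qed.

Let e_gram : \matrix_(p, q) cdot M (toC (e p)) (toC (e q)) \in unitmx.
Proof.
have -> : \matrix_(p, q) cdot M (toC (e p)) (toC (e q)) = toC (minkowski R).
  by apply/matrixP => p q; rewrite [LHS]mxE cdot_toC canonical_frame_dot
    [RHS]mxE.
have mm : minkowski R *m minkowski R = 1%:M.
  rewrite /minkowski mulmx_diag; apply/matrixP => i j; rewrite !mxE.
  by case: (i == ord0); rewrite ?mulrNN mulr1.
by have [] := mulmx1_unit (etrans (esym (map_mxM _ _ _)) (etrans (congr1 toC
  mm) (map_mx1 _ _))).
Qed.

(** Both sides are compared on the frame, a basis: [Z i] exchanges [E0] and [y i] up to a factor and
    kills the other [y j]. *)
Lemma real_part_canonical i :
  X i + conjm (X i) = sqrtC 2 *: wedge M E0 (y i).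
Proof.
apply: (@rise_inj _ M); apply: (gram_ext e_gram) => p.
rewrite riseZ -scalemxAl rise_wedge.
have [->|[j ->]] := I4P p; rewrite ?e_ord0 ?e_lift.
  by rewrite Z_e0 cdot_e0 cdotZl cdotC cdot_e0w mulr0 scale0r sub0r scaleN1r
    opprK.
rewrite Z_y cdot_y cdotZr cdot_e0w mulr0 scale0r subr0.
by rewrite scalerA mulrC.
Qed.

Let toCM m n q (A : 'M[R]_(m, n)) (B : 'M[R]_(n, q)) :
  toC (A *m B) = toC A *m toC B.
Proof. exact: map_mxM. Qed.

Let timelike_planeP i (x : 'cV[R]_4) (z : 'cV[C]_4) :
  conjm z = z -> toC x = (sqrtC 2)^-1 *: (Z i *m z) -> timelike_plane M (X i) x.
Proof.
(* [Z i] is twice the raised real part of [X i], so the factor [(sqrtC 2)^-1] calls for the witness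
   [sqrtC 2 *: z]. *)
move=> zr xE; exists (map_mx (@complex.Re R) (sqrtC 2 *: z)).
apply: (map_mx_inj (f := real_complex R)); rewrite xE !toCM.
rewrite (@conj_fixed_toC _ _ _ (_ *: z)); last by rewrite conjmZ zr s2C.
have reE : toC (map_mx (@complex.Re R) (X i)) = 2^-1 *: (X i + conjm (X i)).
  by apply/matrixP => p q; rewrite !mxE ReJ_add mulrC.
rewrite reE -!scalemxAr -scalemxAl scalerA riseE; congr (_ *: _).
have -> : 2^-1 = (sqrtC 2)^-1 * (sqrtC 2)^-1 :> C by rewrite -invfM sqr2.
by rewrite mulrA mulfV ?mul1r // sqrtC2_neq0.
Qed.

(** The range of a skew operator is orthogonal to its kernel. *)
Let timelike_ortho i (u x : 'cV[R]_4) :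
  Z i *m toC x = 0 -> timelike_plane M (X i) u -> dot M u x = 0.
Proof.
move=> zx [z ->]; apply: (@complexI R); rewrite -cdot_toC !toCM.
have reE : toC (map_mx (@complex.Re R) (X i)) = 2^-1 *: (X i + conjm (X i)).
  by apply/matrixP => p q; rewrite !mxE ReJ_add mulrC.
rewrite reE -scalemxAr -scalemxAl cdotZl -riseE rise_skew // zx.
by rewrite -(scale0r 0) cdotZr mul0r oppr0 mulr0 rmorph0.
Qed.

Lemma weyl_canonical_frameP : weyl_canonical_frame M X canonical_frame.
Proof.
have tl i : timelike_plane M (X i) (e (lift ord0 i)).
  apply: (timelike_planeP (z := E0)); first exact: conj_toC.
  by rewrite Z_e0 scalerK ?sqrtC2_neq0 // e_lift.
split => //.
- exact: canonical_frame_dot.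
- by rewrite e_ord0.
- move=> i; apply: (timelike_planeP (conj_y i)).
  by rewrite Z_y eqxx mul1r scalerK ?sqrtC2_neq0 // e_ord0.
- move=> i j; case: eqP => [<-|/eqP ij]; first exact: tl.
  move=> u; apply: timelike_ortho.
  by rewrite e_lift Z_y (negPf ij) mul0r scale0r.
- move=> i; rewrite e_ord0 e_lift /=.
  (* Once the wedge is the rescaled real part of [X i], self-duality supplies its Hodge dual. *)
  have F : wedge M E0 (y i) = (sqrtC 2)^-1 *: (X i + conjm (X i)).
    by rewrite real_part_canonical scalerK ?sqrtC2_neq0 //.
  rewrite F; have := self_dual_part (Xsd i).
  move: (X i + _) => H HE.
  have -> : hodge M ((sqrtC 2)^-1 *: H) = (sqrtC 2)^-1 *: hodge M H.
    exact: linearZ.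
  rewrite [_ *: ((sqrtC 2)^-1 *: _)]scalerA mulrC -scalerA -scalerBr HE
    !scalerA.
  by rewrite -invfM sqr2 mulVf ?scale1r // pnatr_eq0.
Qed.

Lemma canonical_frame_app i :
  toC (e (lift ord0 i)) = sqrtC 2 *: form_app M (X i) (toC (e ord0)).
Proof. by rewrite e_lift e_ord0 riseE. Qed.

End CanonicalFrame.

(** * Future-pointing causal vectors in null components *)

Lemma reversed_cauchy_schwarz (F : numClosedFieldType) (a b c x y z : F) :
  0 < b -> c * c^* <= a * b -> 0 < x -> z * z^* < x * y ->
  0 < a * x + b * y - (c * z + c^* * z^* ).
Proof.
move=> b0 ab x0 xy; rewrite -(pmulr_rgt0 _ (mulr_gt0 b0 x0)).
(* Multiplication by [b * x] exhibits two determinants weighted by squares, plus a squared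
   modulus. *)
have -> : b * x * (a * x + b * y - (c * z + c^* * z^* )) =
    (a * b - c * c^* ) * x ^+ 2 + (x * y - z * z^* ) * b ^+ 2
    + (c^* * x - b * z) * (c * x - b * z^* ) by ring.
have -> : c * x - b * z^* = (c^* * x - b * z)^*.
  have [bR xR] : b^* = b /\ x^* = x by split; rewrite conj_Creal // gtr0_real.
  by rewrite rmorphB !rmorphM /= conjCK bR xR.
by rewrite ltr_wpDr ?mul_conjC_ge0 // ltr_wpDl ?mulr_ge0 ?mulr_gt0 ?subr_ge0
  ?subr_gt0 ?exprn_ge0 ?exprn_gt0 // ltW.
Qed.

Section Future.

Variables (R : rcfType) (M : spacetime_point R).
Variables (l k : 'cV[R]_4) (m : 'cV[R[i]]_4).
Hypothesis nf : null_frame M l k m.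
Local Notation C := R[i].
Local Notation toC := (map_mx (real_complex R)).
Local Notation conjm := (map_mx Num.conj).
Local Notation L := (toC l).
Local Notation K := (toC k).
Local Notation mb := (conjm m).
Local Notation s := ((sqrtC 2)^-1 : C).
Let nt : null_tetrad M L K m mb := null_frame_tetrad nf.

(** The arrow has components [x] and [y], positive as [l] and [k] are future-pointing, and [z]; its
    square is [2 * (z * z^* - x * y)], so being time-like is the strict hypothesis of
    [reversed_cauchy_schwarz]. *)
Lemma future_combination (a b c : C) (e : 'cV[R]_4) :
  0 < b -> c * c^* <= a * b ->
  toC e = a *: L + b *: K + c *: m + c^* *: mb ->
  dot M e (time_arrow M) < 0.
Proof.
move=> b0 ab eE; pose t := toC (time_arrow M).
have [[[_ lt] [_ kt]] _ _ _] := nf.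
have X0 : 0 < - cdot M L t by rewrite oppr_gt0 cdot_toC -(rmorph0 (real_complex
  R)) ltcR.
have Y0 : 0 < - cdot M K t by rewrite oppr_gt0 cdot_toC -(rmorph0 (real_complex
  R)) ltcR.
have zb : cdot M mb t = (cdot M m t)^* by rewrite -cdot_conj conj_toC.
have tt : cdot M t t < 0.
  by rewrite cdot_toC -(rmorph0 (real_complex R)) ltcR time_arrow_timelike.
have et : cdot M (toC e) t < 0.
  rewrite eE !cdotDl !cdotZl zb; move: tt; rewrite {1 2}(tetrad_expansion nt t).
  rewrite (cdot_tetrad nt) zb.
  move: X0 Y0 ; set x := - cdot M L t; set y := - cdot M K t.
  set z := cdot M m t => X0 Y0 tt.
  have -> : cdot M L t = - x by rewrite opprK.
  have -> : cdot M K t = - y by rewrite opprK.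
  have zz : z * z^* < x * y.
    rewrite -(ltr_pM2l (_ : 0 < 2)) ?ltr0n // -subr_lt0.
    apply: le_lt_trans tt; rewrite le_eqVlt; apply/orP; left; apply/eqP.
    by move: (x) (y) (z) (z^* ) => *; ring.
  have := reversed_cauchy_schwarz b0 ab X0 zz.
  rewrite -oppr_lt0; congr (_ < 0).
  by move: (x) (y) (z) (z^* ) (c^* ) => *; ring.
by rewrite -ltcR rmorph0 -cdot_toC.
Qed.

End Future.

(** * From an oriented orthonormal triad to the explicit frame *)

Section OrthonormalTriad.

Variables (R : rcfType) (M : spacetime_point R).
Variables (l k : 'cV[R]_4) (m : 'cV[R[i]]_4).
Hypothesis nf : null_frame M l k m.
Local Notation C := R[i].
Local Notation toC := (map_mx (real_complex R)).
Local Notation conjm := (map_mx Num.conj).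
Local Notation L := (toC l).
Local Notation K := (toC k).
Local Notation mb := (conjm m).
Local Notation s := ((sqrtC 2)^-1 : C).
Let nt : null_tetrad M L K m mb := null_frame_tetrad nf.

Variables a b c : 'I_3 -> C.
Local Notation X := (fun i => biv M l k m (a i) (b i) (c i)).
Local Notation w := (fun i => rise M (biv M l k m (a i) (b i) (c i))).
Local Notation v := (fun i => rise M (conjm (biv M l k m (a i) (b i) (c i)))).
Hypothesis orthonormal :
  forall i j, b i * b j - (a i * c j + c i * a j) / 2 = (i == j)%:R.
Hypothesis orientedX : oriented M X.

Lemma triad_sqr i : w i *m w i = (2^-1)%:M.
Proof.
have := rise_biv_anticomm nf (a i) (b i) (c i) (a i) (b i) (c i).
rewrite orthonormal eqxx -mulr2n -scaler_nat => e.
by rewrite -[LHS](scalerK (_ : 2 != 0 :> C)) ?pnatr_eq0 // e scale_scalar_mx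
  mulr1.
Qed.

Lemma triad_anticomm i j : i != j -> w i *m w j = - (w j *m w i).
Proof.
move=> /negPf ij; apply/eqP; rewrite -addr_eq0.
by rewrite (rise_biv_anticomm nf) orthonormal ij raddf0.
Qed.

Lemma triad_comm i j : w i *m v j = v j *m w i.
Proof. exact: (rise_biv_comm_conj nf). Qed.

Local Notation kappa := (- 'i / sqrtC 2 : C).

Lemma triad_quaternionic : quaternionic 2^-1 kappa w.
Proof.
apply: quaternionic_oriented.
- by rewrite pnatr_eq0.
- by rewrite expr_div_n sqrrN sqrCi sqrtCK mulN1r.
- by move=> i; apply: etrans (triad_sqr i) _; rewrite scalemx1.
- by move=> i j ij; apply: triad_anticomm; rewrite eq_sym.
- exact: (proj1 (oriented_biv M l k m a b c) orientedX).
Qed.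

(** Conjugation is multiplicative and changes the sign of ['i], hence the opposite constant that
    [intertwinerP] requires. *)
Lemma conj_triad_quaternionic : quaternionic 2^-1 (- kappa) v.
Proof.
have vE i j : v i *m v j = conjm (w i *m w j) by rewrite !rise_conj
  [RHS]map_mxM.
have kE : kappa^* = - kappa.
  by rewrite rmorphM rmorphN /= conjCi sqrtC2V_conj !mulNr !opprK.
move=> i; have [e1 e2 e3] := triad_quaternionic i; split.
- apply: etrans (vE _ _) _; rewrite (e1 : w i *m w i = _) conjmZ.
  by congr (_ *: _); rewrite ?fmorphV ?rmorph_nat // map_mx1.
- apply: etrans (vE _ _) _; rewrite (e2 : w i *m w _ = _) conjmZ kE.
  by rewrite rise_conj.
- apply: etrans (vE _ _) _; rewrite (e3 : w _ *m w i = _) map_mxN conjmZ kE.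
  by rewrite rise_conj.
Qed.

Local Notation Kt := (intertwiner w v : 'M[C]_4).

Let two_neq0 : 2 != 0 :> C. Proof. by rewrite pnatr_eq0. Qed.

Lemma intertwiner_app (x : 'cV[C]_4) :
  Kt *m x = x + 2 *: \sum_j w j *m (v j *m x).
Proof.
rewrite /intertwiner mulmxDl -scalemxAl mulmx_suml [1 *m x]mul1mx.
by congr (_ + _ *: _); apply: eq_bigr => j _; rewrite mulmxA.
Qed.

Lemma triad_intertwine i (x : 'cV[C]_4) : w i *m (Kt *m x) = v i *m (Kt *m x).
Proof.
rewrite !mulmxA; congr (_ *m x).
exact: (intertwinerP two_neq0 triad_quaternionic conj_triad_quaternionic
  triad_comm).
Qed.

Lemma intertwiner_twice (x : 'cV[C]_4) : Kt *m (Kt *m x) = 4 *: (Kt *m x).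
Proof.
rewrite mulmxA scalemxAl; congr (_ *m x).
exact: (intertwiner_sqr two_neq0 triad_quaternionic conj_triad_quaternionic
  triad_comm).
Qed.

(** Conjugation exchanges the two commuting factors of each term, so the operator is real. *)
Lemma conj_intertwiner_app (x : 'cV[C]_4) : conjm (Kt *m x) = Kt *m conjm x.
Proof.
rewrite !intertwiner_app map_mxD conjmZ conjC_nat map_mx_sum.
congr (_ + _ *: _); apply: eq_bigr => j _.
by rewrite /= -!rise_conj_app conjmK !mulmxA triad_comm.
Qed.

(** Each term is a product of two commuting skew operators, hence symmetric. *)
Lemma intertwiner_selfadjoint (x y : 'cV[C]_4) :
  cdot M (Kt *m x) y = cdot M x (Kt *m y).
Proof.
have wsk i : (X i)^T = - X i by case: (biv_self_dual nf (a i) (b i) (c i)).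
have vsk i : (conjm (X i))^T = - conjm (X i) by rewrite map_trmx wsk map_mxN.
rewrite !intertwiner_app cdotDl cdotZl (raddfD (cdot M x)) /= cdotZr.
congr (_ + _ * _); rewrite cdotC !raddf_sum; apply: eq_bigr => j _ /=.
rewrite cdotC rise_skew ?wsk // rise_skew ?vsk // opprK.
by rewrite !mulmxA triad_comm.
Qed.

(** [triad_b] and [triad_c] are the components of the image of [l] along [k] and [m]. *)
Definition triad_b : C := \sum_j `|c j| ^+ 2.
Definition triad_c : C := - \sum_j (b j)^* * c j.

Lemma intertwiner_l :
  Kt *m L = (1 + \sum_j b j * (b j)^* ) *: L + triad_b *: K + triad_c *: m
            + triad_c^* *: mb.
Proof.
have sE j : 2 *: (w j *m (v j *m L)) =
    b j * (b j)^* *: L + `|c j| ^+ 2 *: K - ((b j)^* * c j) *: m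
    - ((b j)^* * c j)^* *: mb.
  rewrite conj_biv biv_scale !riseZ -!scalemxAl -scalemxAr !scalerA -mulrA
    sqr_sqrtC2V.
  rewrite mulfV // scale1r.
  have [eL _ _ emb] := biv0_frame nt (a j) (b j) (c j).
  have [fL _ _ _] := conj_biv0_frame nt (conj_toC l) (conj_toC k) erefl
    (conjmK m) (a j) (b j) (c j).
  rewrite fL mulmxBr -!scalemxAr eL emb normCK rmorphM /= conjCK.
  move: (toC l) (toC k) m mb (a j) (b j) (c j) (b j)^* (c j)^*.
  by move=> ? ? ? ? ? ? ? ? ?; apply/colP => p; rewrite !mxE; ring.
rewrite intertwiner_app scaler_sumr (eq_bigr _ (fun j _ => sE j)).
rewrite !sumrB big_split /= -!scaler_suml scalerDl scale1r /triad_b /triad_c.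
by rewrite rmorphN rmorph_sum /= !scaleNr !addrA.
Qed.

(** If every [c j] vanished, orthonormality would give numbers [b i] with squares 1 and pairwise
    products 0. *)
Lemma triad_b_gt0 : 0 < triad_b.
Proof.
have b0 : 0 <= triad_b by apply: sumr_ge0 => j _; rewrite exprn_ge0.
rewrite lt_neqAle b0 andbT eq_sym; apply/eqP => e.
have c0 j : c j = 0.
  have /psumr_eq0P/(_ e j isT)/eqP : forall j, true -> 0 <= `|c j| ^+ 2 :> C.
    by move=> i _; rewrite exprn_ge0.
  by rewrite expf_eq0 normr_eq0 /= => /eqP.
have bb i j : b i * b j = (i == j)%:R.
  by rewrite -orthonormal !c0 mulr0 mul0r addr0 mul0r subr0.
have := bb ord0 ord_max; have := bb ord_max ord_max; have := bb ord0 ord0.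
rewrite !eqxx => e1 e2 /eqP; rewrite mulf_eq0 => /orP[]/eqP b00.
  by move: e1; rewrite b00 mul0r => /esym/eqP; rewrite oner_eq0.
by move: e2; rewrite b00 mul0r => /esym/eqP; rewrite oner_eq0.
Qed.

Definition triad_a : C := 2 + triad_c * triad_c^* / triad_b.

Lemma intertwiner_l_norm : cdot M (Kt *m L) (Kt *m L) = - 4 * triad_b.
Proof.
rewrite intertwiner_selfadjoint intertwiner_twice cdotZr intertwiner_l.
have LE : L = 1 *: L + 0 *: K + 0 *: m + 0 *: mb.
  by rewrite scale1r !scale0r !addr0.
rewrite {1}LE (cdot_tetrad nt).
by move: (1 + _) triad_b triad_c => ? ? ?; ring.
Qed.

(** Computed from components, the norm of the image of [l] is [2 * (c * c^* - a * b)]; equating it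
    with [- 4 * b] determines [a]. *)
Lemma triad_aE : 1 + \sum_j b j * (b j)^* = triad_a.
Proof.
have := intertwiner_l_norm; rewrite intertwiner_l (cdot_tetrad nt) /triad_a.
have := lt0r_neq0 triad_b_gt0.
move: (1 + _) triad_b triad_c => p q r q0 e.
apply: (mulIf q0); rewrite mulrDl mulfVK //.
apply: (mulfI two_neq0); rewrite mulrDr.
apply/eqP; rewrite -subr_eq0; apply/eqP.
by move: e; move: (r^* ) => rc /eqP; rewrite -subr_eq0 => /eqP e; rewrite
  -[RHS]oppr0 -e; ring.
Qed.

Lemma triad_ab : triad_c * triad_c^* <= triad_a * triad_b.
Proof.
rewrite /triad_a mulrDl mulfVK ?lt0r_neq0 ?triad_b_gt0 // lerDr.
by rewrite mulr_ge0 ?ler0n // ltW // triad_b_gt0.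
Qed.

Lemma triad_ab_scale (t : C) : 0 < t ->
  (t * triad_c) * (t * triad_c)^* <= (t * triad_a) * (t * triad_b).
Proof.
move=> t0; have tR : t^* = t by rewrite conj_Creal // gtr0_real.
have -> : (t * triad_c)^* = t * triad_c^* by rewrite rmorphM /= tR.
by rewrite [leLHS]mulrACA [leRHS]mulrACA ler_pM2l ?mulr_gt0 // triad_ab.
Qed.

Lemma triad_weyl_canonical_frame :
  exists e : 'I_4 -> 'cV[R]_4,
  [/\ weyl_canonical_frame M X e,
      toC (e ord0) = (2 * sqrtC triad_b)^-1 *: (triad_a *: L + triad_b *: K
                       + triad_c *: m + triad_c^* *: mb)
    & forall i, toC (e (lift ord0 i)) = sqrtC 2 *: form_app M (X i) (toC (e
      ord0))].
Proof.
rewrite -triad_aE -intertwiner_l.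
(* The image of [l] has square [- 4 * triad_b], so this positive factor normalises it to [-1]. *)
pose t := (2 * sqrtC triad_b)^-1.
have t0 : 0 < t by rewrite invr_gt0 mulr_gt0 ?ltr0n // sqrtC_gt0 triad_b_gt0.
have tR : t^* = t by rewrite conj_Creal // gtr0_real.
have tt : t * t = (4 * triad_b)^-1.
  by rewrite -invfM mulrACA -[sqrtC _ * _]expr2 sqrtCK -natrM.
pose e0 : 'cV[R]_4 := map_mx (@complex.Re R) (t *: (Kt *m L)).
have e0E : toC e0 = t *: (Kt *m L).
  by apply: conj_fixed_toC; rewrite conjmZ tR conj_intertwiner_app conj_toC.
have ne : dot M e0 e0 = -1.
  apply: (@complexI R); rewrite -cdot_toC e0E cdotZl cdotZr mulrA tt.
  rewrite intertwiner_l_norm mulNr mulrN mulVf ?rmorphN1 //.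
  by rewrite mulf_neq0 ?pnatr_eq0 // lt0r_neq0 // triad_b_gt0.
have fe : future M e0.
  split; first by rewrite ne lerN10.
  apply: (@future_combination _ _ _ _ _ nf (t * triad_a) (t * triad_b) (t *
    triad_c)).
  - exact: mulr_gt0 t0 triad_b_gt0.
  - exact: triad_ab_scale t0.
  - rewrite e0E intertwiner_l triad_aE !scalerDr !scalerA.
    have -> : (t * triad_c)^* = t * triad_c^* by rewrite rmorphM /= tR.
    reflexivity.
exists (canonical_frame M X e0).
have sd i : self_dual M (X i) by exact: (biv_self_dual nf).
have re i : w i *m toC e0 = v i *m toC e0.
  by rewrite e0E -!scalemxAr; congr (_ *: _); apply: triad_intertwine.
split.
- exact: (weyl_canonical_frameP sd triad_sqr triad_anticomm triad_comm re ne
  fe).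
- rewrite /canonical_frame unlift_none; exact: e0E.
- exact: (canonical_frame_app re).
Qed.

End OrthonormalTriad.

(** * Components of the Weyl tensor *)

Section WeylAlgebra.

Variables (F : numClosedFieldType) (P0 P1 P2 P3 P4 : F).
Local Notation I := (weyl_I P0 P1 P2 P3 P4).
Local Notation J := (weyl_J P0 P1 P2 P3 P4).

Definition weyl_A x : F :=
  P0 * P4 + P2 ^+ 2 - 2 * P1 * P3 + x * P2 + (x ^+ 2 - I).
Definition weyl_B x : F := P1 * P4 - P2 * P3 + P3 * x.
Definition weyl_C x : F := 2 * P2 * P4 - 2 * P3 ^+ 2 + x * P4.
(** Minus half the derivative of the characteristic polynomial: at a root it vanishes exactly when
    the root is multiple. *)
Definition weyl_D x : F := 2^-1 * (I - 3 * x ^+ 2).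

Lemma weyl_JE : J =
  2 * P1 * P2 * P3 + P0 * P2 * P4 - P2 ^+ 3 - P0 * P3 ^+ 2 - P1 ^+ 2 * P4.
Proof.
rewrite /weyl_J (expand_det_row _ ord0) !big_ord_recl big_ord0 /cofactor.
rewrite !(expand_det_row _ ord0) !big_ord_recl !big_ord0 /cofactor !det_mx11
  !mxE /=.
ring.
Qed.

(** The matrix of the Weyl endomorphism in the base [U], [W], [V]; the factors [- 2] reflect that
    [W] has square [-1] while [U] and [V] have product 1/2. *)
Definition weyl_matrix : 'M[F]_3 := \matrix_(i, j) nth 0 (nth [::]
  [:: [:: P2; - (2 * P1); P0]; [:: P3; - (2 * P2); P1]; [:: P4; - (2 * P3);
    P2]] i) j.

Lemma det_weyl_matrix x : \det (x%:M - weyl_matrix) = x ^+ 3 - I * x - 2 * J.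
Proof.
rewrite weyl_JE /weyl_I (expand_det_row _ ord0) !big_ord_recl big_ord0
  /cofactor.
rewrite !(expand_det_row _ ord0) !big_ord_recl !big_ord0 /cofactor !det_mx11
  !mxE /=.
ring.
Qed.

Section Roots.

Variables (delta beta : F).
Hypotheses (delta2 : delta ^+ 2 = J ^+ 2 - I ^+ 3 / 27) (beta3 : beta ^+ 3 = J
  + delta)
  (beta0 : beta != 0).
Local Notation alpha := (weyl_root I beta).

Let s : F := 'i * sqrtC 3.
Let s2 : s ^+ 2 = -3.
Proof. by rewrite exprMn sqrCi sqrtCK mulN1r. Qed.

Let tE : I = 3 * beta * (I / (3 * beta)).
Proof. by rewrite mulrC mulfVK // mulf_neq0 ?pnatr_eq0. Qed.

Let alphaE (t := I / (3 * beta)) :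
  [/\ alpha 0 = beta + t, alpha 1 = - (2^-1 * ((1 - s) * beta + (1 + s) * t))
    & alpha (1 + 1) = - (2^-1 * ((1 + s) * beta + (1 - s) * t))].
Proof. by []. Qed.

Lemma weyl_root_prod x : \prod_i (x - alpha i) = x ^+ 3 - I * x - 2 * J.
Proof.
have [e0 e1 e2] := alphaE.
rewrite !big_ord_recl big_ord0 mulr1.
have -> : lift ord0 ord0 = 1 :> 'I_3 by exact: val_inj.
have -> : lift ord0 (lift ord0 ord0) = 1 + 1 :> 'I_3 by exact: val_inj.
have -> : ord0 = 0 :> 'I_3 by exact: val_inj.
rewrite e0 e1 e2 {e0 e1 e2}; move: tE; set t := I / (3 * beta) => It.
(* Cardano's argument: the product of [beta ^+ 3] and [t ^+ 3] is [J ^+ 2 - delta ^+ 2], so [t ^+ 3]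
   is the other cube [J - delta]. *)
have J2 : 2 * J = beta ^+ 3 + t ^+ 3.
  apply: (mulfI (expf_neq0 3 beta0)).
  have -> : beta ^+ 3 * (beta ^+ 3 + t ^+ 3) = (beta ^+ 3) ^+ 2 + (3 * beta *
    t) ^+ 3 / 27.
    by field.
  have -> : (3 * beta * t) ^+ 3 / 27 = J ^+ 2 - delta ^+ 2 by rewrite -It
    delta2; ring.
  by rewrite beta3; ring.
rewrite J2 It; move: s2; clearbody s t => s2'.
(* The other two roots are [- (beta + t) / 2] plus or minus [s * (beta - t) / 2]. Since [field]
   treats [s] as a variable, [s ^+ 2] is kept explicit for the rewriting by [-3]. *)
have -> : (x - - (2^-1 * ((1 - s) * beta + (1 + s) * t)))
    * (x - - (2^-1 * ((1 + s) * beta + (1 - s) * t))) =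
    x ^+ 2 + x * (beta + t) + ((beta + t) ^+ 2 - s ^+ 2 * (beta - t) ^+ 2) / 4.
  by field.
by rewrite s2'; field.
Qed.

(** Up to sign, both sides are the derivative of the characteristic polynomial at its root
    [alpha i]. Each case is checked on the explicit formulas. *)
Lemma weyl_root_deriv (i : 'I_3) :
  I - 3 * alpha i ^+ 2 =
  - ((alpha i - alpha (i + 1)) * (alpha i - alpha (i + 1 + 1))).
Proof.
have [e0 e1 e2] := alphaE.
have p3 : 1 + 1 + 1 = 0 :> 'I_3 by exact: val_inj.
case: i => [[|[|[|//]]] p].
- rewrite (_ : Ordinal p = 0); last exact: val_inj.
  rewrite add0r e0 e1 e2; move: tE s2; set t := I / (3 * beta).
  clearbody s t => -> s2'.
  have -> : - ((beta + t - - (2^-1 * ((1 - s) * beta + (1 + s) * t)))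
      * (beta + t - - (2^-1 * ((1 + s) * beta + (1 - s) * t)))) =
      - ((beta + t) ^+ 2 * 9 - s ^+ 2 * (beta - t) ^+ 2) / 4 by field.
  by rewrite s2'; field.
- rewrite (_ : Ordinal p = 1); last exact: val_inj.
  rewrite p3 e0 e1 e2; move: tE s2; set t := I / (3 * beta).
  clearbody s t => -> s2'.
  have -> : 3 * (- (2^-1 * ((1 - s) * beta + (1 + s) * t))) ^+ 2 =
      3 / 4 * ((beta + t) ^+ 2 - 2 * s * (beta ^+ 2 - t ^+ 2) + s ^+ 2 * (beta
        - t) ^+ 2).
    by field.
  have -> : - ((- (2^-1 * ((1 - s) * beta + (1 + s) * t))
        - - (2^-1 * ((1 + s) * beta + (1 - s) * t)))
      * (- (2^-1 * ((1 - s) * beta + (1 + s) * t)) - (beta + t))) =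
      s * (beta - t) * (beta + t) * 3 / 2 - s ^+ 2 * (beta - t) ^+ 2 / 2 by
        field.
  by rewrite s2'; field.
- rewrite (_ : Ordinal p = 1 + 1); last exact: val_inj.
  rewrite p3 add0r e0 e1 e2; move: tE s2; set t := I / (3 * beta).
  clearbody s t => -> s2'.
  have -> : 3 * (- (2^-1 * ((1 + s) * beta + (1 - s) * t))) ^+ 2 =
      3 / 4 * ((beta + t) ^+ 2 + 2 * s * (beta ^+ 2 - t ^+ 2) + s ^+ 2 * (beta
        - t) ^+ 2).
    by field.
  have -> : - ((- (2^-1 * ((1 + s) * beta + (1 - s) * t)) - (beta + t))
      * (- (2^-1 * ((1 + s) * beta + (1 - s) * t))
        - - (2^-1 * ((1 - s) * beta + (1 + s) * t)))) =
      - s * (beta - t) * (beta + t) * 3 / 2 - s ^+ 2 * (beta - t) ^+ 2 / 2 by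
        field.
  by rewrite s2'; field.
Qed.

End Roots.

Section Root.

Variable x : F.
Hypothesis rx : x ^+ 3 - I * x - 2 * J = 0.

(** Up to sign this is the square of the unnormalised eigenform, whence the radicand in the
    normalisation. *)
Lemma weyl_ABC_norm : weyl_B x ^+ 2 - weyl_A x * weyl_C x = weyl_D x * weyl_C x.
Proof.
have e : weyl_B x ^+ 2 - weyl_A x * weyl_C x - weyl_D x * weyl_C x =
    P4 / 2 * (x ^+ 3 - I * x - 2 * J).
  by rewrite weyl_JE /weyl_A /weyl_B /weyl_C /weyl_D /weyl_I; field.
by apply/eqP; rewrite -subr_eq0 e rx mulr0.
Qed.

(** The last two rows are polynomial identities; the first one is off by the characteristic
    polynomial, which vanishes at [x]. *)
Lemma weyl_ABC_eigen :
  [/\ P2 * weyl_A x - 2 * P1 * weyl_B x + P0 * weyl_C x = x * weyl_A x,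
      P3 * weyl_A x - 2 * P2 * weyl_B x + P1 * weyl_C x = x * weyl_B x
    & P4 * weyl_A x - 2 * P3 * weyl_B x + P2 * weyl_C x = x * weyl_C x].
Proof.
split; last first.
- by rewrite /weyl_A /weyl_B /weyl_C /weyl_I; ring.
- by rewrite /weyl_A /weyl_B /weyl_C /weyl_I; ring.
have e : P2 * weyl_A x - 2 * P1 * weyl_B x + P0 * weyl_C x - x * weyl_A x =
    - (x ^+ 3 - I * x - 2 * J).
  by rewrite weyl_JE /weyl_A /weyl_B /weyl_C /weyl_D /weyl_I; ring.
by apply/eqP; rewrite -subr_eq0 e rx oppr0.
Qed.

End Root.

(** A symmetric endomorphism has orthogonal eigenvectors for distinct eigenvalues. *)
Lemma weyl_ABC_ortho x y :
  x ^+ 3 - I * x - 2 * J = 0 -> y ^+ 3 - I * y - 2 * J = 0 ->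
  x != y ->
  weyl_B x * weyl_B y - (weyl_A x * weyl_C y + weyl_C x * weyl_A y) / 2 = 0.
Proof.
move=> /weyl_ABC_eigen[a1 a2 a3] /weyl_ABC_eigen[b1 b2 b3] xy.
apply: (mulfI (_ : x - y != 0)); first by rewrite subr_eq0.
move: a1 a2 a3 b1 b2 b3; move: (weyl_A x) (weyl_B x) (weyl_C x) (weyl_A y)
  (weyl_B y) (weyl_C y) => a b c a' b' c' a1 a2 a3 b1 b2 b3.
have -> : (x - y) * (b * b' - (a * c' + c * a') / 2) =
  (x * b) * b' - ((x * a) * c' + (x * c) * a') / 2
  - (b * (y * b') - (a * (y * c') + c * (y * a')) / 2) by field.
by rewrite -a1 -a2 -a3 -b1 -b2 -b3; field.
Qed.

Lemma weyl_ABC_orthonormal (z r : 'I_3 -> F) (i j : 'I_3) :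
  injective z -> (forall i, z i ^+ 3 - I * z i - 2 * J = 0) ->
  (forall i, r i ^+ 2 = weyl_D (z i) * weyl_C (z i)) -> (forall i, r i != 0) ->
  weyl_B (z i) / r i * (weyl_B (z j) / r j)
  - (weyl_A (z i) / r i * (weyl_C (z j) / r j)
     + weyl_C (z i) / r i * (weyl_A (z j) / r j)) / 2 = (i == j)%:R.
Proof.
move=> zi rz r2 r0.
have -> : weyl_B (z i) / r i * (weyl_B (z j) / r j)
  - (weyl_A (z i) / r i * (weyl_C (z j) / r j)
     + weyl_C (z i) / r i * (weyl_A (z j) / r j)) / 2 =
  (weyl_B (z i) * weyl_B (z j) - (weyl_A (z i) * weyl_C (z j)
    + weyl_C (z i) * weyl_A (z j)) / 2) / (r i * r j).
  by field; rewrite !r0.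
have [<-|ij] := eqVneq i j; last by rewrite weyl_ABC_ortho ?mul0r ?(inj_eq zi).
have -> : weyl_B (z i) * weyl_B (z i) - (weyl_A (z i) * weyl_C (z i)
    + weyl_C (z i) * weyl_A (z i)) / 2 = r i ^+ 2.
  by rewrite r2 -weyl_ABC_norm //; field.
by rewrite -expr2 mulfV ?expf_neq0.
Qed.

(* Two of the [weyl_C] vanish only if [P3 = P4 = 0], and then [P2] is a double
   root. *)
Lemma weyl_C_eq0 x y (z : 'I_3 -> F) : x != y -> weyl_C x = 0 -> weyl_C y = 0 ->
  (forall t, \prod_i (t - z i) = t ^+ 3 - I * t - 2 * J) ->
  (forall i, weyl_D (z i) != 0) -> False.
Proof.
move=> xy cx cy zE zD.
have p4 : P4 = 0.
  have : (x - y) * P4 = 0 by rewrite -[RHS](subrr 0) -{1}cx -cy /weyl_C; ring.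
  by move/eqP; rewrite mulf_eq0 subr_eq0 (negPf xy) => /eqP.
have p3 : P3 = 0.
  move: cx; rewrite /weyl_C p4 !mulr0 addr0 sub0r => /eqP.
  by rewrite oppr_eq0 mulf_eq0 pnatr_eq0 expf_eq0 => /eqP.
have := zE P2; rewrite weyl_JE /weyl_I p3 p4.
have -> : P2 ^+ 3 - (P0 * 0 - 4 * P1 * 0 + 3 * P2 ^+ 2) * P2
  - 2 * (2 * P1 * P2 * 0 + P0 * P2 * 0 - P2 ^+ 3 - P0 * 0 ^+ 2 - P1 ^+ 2 * 0) =
    0 by ring.
move/eqP/prodf_eq0 => [i _]; rewrite subr_eq0 => /eqP e.
move: (zD i); rewrite /weyl_D -e /weyl_I p3 p4 !mulr0 subr0 add0r subrr mulr0.
by rewrite eqxx.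
Qed.

End WeylAlgebra.

(** In dimension three the cross product of the first two vectors of an orthonormal triad is a
    multiple of the third; its length fixes the factor up to the sign [e]. *)
Lemma orthonormal_cross (F : numClosedFieldType) (a b c : 'I_3 -> F) :
  (forall i j, b i * b j - (a i * c j + c i * a j) / 2 = (i == j)%:R) ->
  exists e : F, e ^+ 2 = 1 /\
   [/\ 2 * (a 0 * b 1 - b 0 * a 1) = - 2 * 'i * e * a (1 + 1),
       a 0 * c 1 - c 0 * a 1 = - 2 * 'i * e * b (1 + 1)
     & 2 * (b 0 * c 1 - c 0 * b 1) = - 2 * 'i * e * c (1 + 1)].
Proof.
move=> h; set x := 2 * _; set y := _ - _; set z := 2 * (b 0 * _ - _).
pose O : 'M[F]_3 := \matrix_(i, j) nth 0 [:: a i; b i; c i] j.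
(* The columns of [O'] are the metric duals of the rows of [O], so [O' *m O = 1] expands any vector
   in the triad. *)
pose O' : 'M[F]_3 := \matrix_(j, i) nth 0 [:: - c i / 2; b i; - a i / 2] j.
have OO' : O *m O' = 1%:M.
  apply/matrixP => i j; rewrite [RHS]mxE -h mxE !big_ord_recl big_ord0 !mxE /=.
  by field.
pose v : 'rV[F]_3 := \row_j nth 0 [:: x; y; z] j.
pose lam := y * b (1 + 1) - (x * c (1 + 1) + z * a (1 + 1)) / 2.
have vO' : v *m O' = lam *: delta_mx 0 (1 + 1).
  apply/rowP => j; rewrite mxE !big_ord_recl big_ord0 !mxE /=.
  case: j => [[|[|[|//]]] p] /=.
  - rewrite (_ : Ordinal p = 0); last exact: val_inj.
    by rewrite /x /y /z mulr0; field.
  - rewrite (_ : Ordinal p = 1); last exact: val_inj.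
    by rewrite /x /y /z mulr0; field.
  - rewrite (_ : Ordinal p = 1 + 1); last exact: val_inj.
    by rewrite /lam; field.
have vE : v = lam *: row (1 + 1) O.
  by rewrite -[LHS]mulmx1 -(mulmx1C OO') mulmxA vO' -scalemxAl -rowE.
have xE : x = lam * a (1 + 1) by have /rowP/(_ 0) := vE; rewrite !mxE.
have yE : y = lam * b (1 + 1) by have /rowP/(_ 1) := vE; rewrite !mxE.
have zE : z = lam * c (1 + 1) by have /rowP/(_ (1 + 1)) := vE; rewrite !mxE.
have lam2 : lam ^+ 2 = - 4.
  have : y ^+ 2 - x * z = lam ^+ 2 * (b (1 + 1) * b (1 + 1)
      - (a (1 + 1) * c (1 + 1) + c (1 + 1) * a (1 + 1)) / 2).
    by rewrite xE yE zE; field.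
  rewrite h eqxx mulr1 => <-.
  (* Lagrange's identity for the square of a cross product. *)
  have -> : y ^+ 2 - x * z =
      4 * (b 0 * b 1 - (a 0 * c 1 + c 0 * a 1) / 2) ^+ 2
      - 4 * (b 0 * b 0 - (a 0 * c 0 + c 0 * a 0) / 2)
          * (b 1 * b 1 - (a 1 * c 1 + c 1 * a 1) / 2).
    by rewrite /x /y /z; field.
  by rewrite !h !eqxx /=; ring.
have i2 : 'i * 'i = -1 :> F by rewrite -expr2 sqrCi.
have lamE : lam = - 2 * 'i * ('i * lam / 2).
  have -> : - 2 * 'i * ('i * lam / 2) = - ('i * 'i) * lam by field.
  by rewrite i2 opprK mul1r.
exists ('i * lam / 2); rewrite -lamE; split; last by split.
by rewrite expr_div_n exprMn sqrCi lam2; field.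
Qed.

(** * The Weyl tensor as an endomorphism, and its distinct eigenvalues *)

Section TypeI.

Variables (R : rcfType) (M : spacetime_point R).
Variables (l k : 'cV[R]_4) (m : 'cV[R[i]]_4).
Hypothesis nf : null_frame M l k m.
Local Notation C := R[i].
Local Notation biv := (biv M l k m).
Variables (S : tensor4 C) (P0 P1 P2 P3 P4 : C).
Hypothesis SE : weyl_components S (frame_U M l m) (frame_W M l k m)
  (frame_V M k m) P0 P1 P2 P3 P4.

(** With the first index pair fixed, the second pair of [S] is a combination of [U], [W], [V], whose
    contraction is given by [form_dot_biv]. *)
Lemma tensor_app_biv x y z :
  tensor_app M S (biv x y z) =
  biv (P2 * x - 2 * P1 * y + P0 * z) (P3 * x - 2 * P2 * y + P1 * z)
      (P4 * x - 2 * P3 * y + P2 * z).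
Proof.
apply/matrixP => p q; rewrite [LHS]mxE.
move: SE; rewrite /weyl_components bivE.
move: (form_dot_biv nf) (bivE M l k m).
move: (frame_U _ _ _) (frame_W _ _ _ _) (frame_V _ _ _) => U W V fd bE SE'.
have -> : \matrix_(c, d) S p q c d =
  biv (2 * (P0 * U p q + P1 * W p q + P2 * V p q))
      (2 * (P1 * U p q + P2 * W p q + P3 * V p q))
      (2 * (P2 * U p q + P3 * W p q + P4 * V p q)).
  apply/matrixP => c d; rewrite bE !mxE.
  rewrite -[LHS](mulVKf (_ : 2 != 0)) ?pnatr_eq0 // SE' /sotimes /otimes.
  by move: (U p q) (W p q) (V p q) (U c d) (W c d) (V c d) => *; ring.
rewrite -bE fd bE !mxE.
by move: (U p q) (W p q) (V p q) => *; field.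
Qed.

End TypeI.

Section TypeIRoots.

Variables (R : rcfType) (M : spacetime_point R).
Local Notation C := R[i].

Lemma form_dot_linear (X : 'M[C]_4) : scalar (form_dot M X).
Proof.
move=> a Y Z; rewrite /form_dot mulrCA -mulrDr; congr (_ * _).
rewrite mulr_sumr -big_split; apply: eq_bigr => p _ /=.
rewrite mulr_sumr -big_split; apply: eq_bigr => q _ /=.
by rewrite /raise mulmxDr mulmxDl -scalemxAr -scalemxAl !mxE mulrDr mulrCA.
Qed.

Lemma tensor_app_sum (S : tensor4 C) (q : 'I_3 -> C) (Y : 'I_3 -> 'M[C]_4) :
  tensor_app M S (\sum_i q i *: Y i) = \sum_i q i *: tensor_app M S (Y i).
Proof.
apply/matrixP => a b; rewrite !big_ord_recl !big_ord0 ![LHS]mxE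
  !form_dot_linear.
have -> : form_dot M (\matrix_(c, d) S a b c d) 0 = 0.
  by have := form_dot_linear (\matrix_(c, d) S a b c d) (-1) 0 0; rewrite
    scaler0 addr0 mulN1r addNr.
by rewrite !mxE.
Qed.

Lemma horner_char_poly (F : comNzRingType) n (A : 'M[F]_n) x :
  (char_poly A).[x] = \det (x%:M - A).
Proof.
rewrite -/(horner_eval x _) /char_poly -det_map_mx; congr (\det _).
apply/matrixP => i j; rewrite /char_poly_mx !mxE /= /horner_eval.
by rewrite hornerD hornerN hornerC hornerMn hornerX.
Qed.

Variables (l k : 'cV[R]_4) (m : 'cV[R[i]]_4).
Hypothesis nf : null_frame M l k m.
Local Notation biv := (biv M l k m).
Variables (S : tensor4 C) (P0 P1 P2 P3 P4 : C).
Hypothesis SE : weyl_components S (frame_U M l m) (frame_W M l k m)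
  (frame_V M k m) P0 P1 P2 P3 P4.

Let B (j : 'I_3) := biv (j == 0)%:R (j == 1)%:R (j == 1 + 1)%:R.

Let B_sum (q : 'I_3 -> C) : \sum_j q j *: B j = biv (q 0) (q 1) (q (1 + 1)).
Proof.
rewrite (sum_I3_cyclic _ 0) add0r /B !bivE; move: (frame_U _ _ _) (frame_W _ _
  _ _) (frame_V _ _ _).
by move=> U W V; rewrite /= !scale0r !addr0 !add0r !scale1r.
Qed.

Local Notation Kmat := (weyl_matrix P0 P1 P2 P3 P4).

Let tensor_B j : tensor_app M S (B j) = \sum_i Kmat i j *: B i.
Proof.
rewrite B_sum /B (tensor_app_biv nf SE) !mxE.
by case: j => [[|[|[|//]]] p] /=; rewrite !mulr0 !mulr1 ?subr0 ?addr0 ?add0r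
  ?sub0r.
Qed.

(** [type_I] refers to some self-dual basis [E]; the change of basis [Q] from the null base makes
    [N] similar to [weyl_matrix], so their characteristic polynomials agree. *)
Lemma type_I_roots : type_I M S -> exists x : 'I_3 -> C, injective x /\
  forall y, \prod_i (y - x i) =
    y ^+ 3 - weyl_I P0 P1 P2 P3 P4 * y - 2 * weyl_J P0 P1 P2 P3 P4.
Proof.
move=> [E [N [x [[fE spanE] NE cN xi]]]]; exists x; split=> // y.
pose Q : 'M[C]_3 := \matrix_(i, j) coord E i (B j).
have BE j : B j = \sum_i Q i j *: tnth E i.
  have /spanE Bspan : self_dual M (B j) by exact: biv_self_dual nf _ _ _.
  rewrite {1}(coord_span Bspan); apply: eq_bigr => i _.
  by rewrite mxE (tnth_nth 0).
have E_inj (p q : 'I_3 -> C) : \sum_i p i *: tnth E i = \sum_i q i *: tnth E i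
  -> p =1 q.
  move=> e i; have Ef (r : 'I_3 -> C) : \sum_i r i *: tnth E i = \sum_i r i *:
    E`_i.
    by apply: eq_bigr => j _; rewrite (tnth_nth 0).
  by rewrite -(coord_sum_free p i fE) -(coord_sum_free q i fE) -!Ef e.
have sum2 (A1 A2 : 'M[C]_3) j :
    \sum_i A2 i j *: (\sum_p A1 p i *: tnth E p) = \sum_p (A1 *m A2) p j *:
      tnth E p.
  under eq_bigr do rewrite scaler_sumr.
  rewrite exchange_big; apply: eq_bigr => p _ /=.
  rewrite mxE scaler_suml; apply: eq_bigr => i _.
  by rewrite scalerA mulrC.
have NQ : N *m Q = Q *m Kmat.
  apply/matrixP => p j; move: p; apply: E_inj; rewrite -!sum2.
  under eq_bigr do rewrite -NE.
  rewrite -tensor_app_sum -BE tensor_B; apply: eq_bigr => i _.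
  by rewrite BE.
(* A kernel vector of [Q] would give a vanishing combination of [U], [W], [V], excluded by
   [biv_inj]. *)
have Q0 : \det Q != 0.
  rewrite -det_tr; apply/det0P => -[v v0 /rowP vQ].
  have : biv (v 0 0) (v 0 1) (v 0 (1 + 1)) = biv 0 0 0.
    rewrite -(B_sum (v 0)) biv_eq0.
    under eq_bigr do rewrite BE.
    (* The vector is repeated as every column of a matrix so that [sum2] applies. *)
    have e := sum2 Q (\matrix_(i, j < 3) v 0 i) 0.
    rewrite (eq_bigr (fun i => (\matrix_(i, j < 3) v 0 i) i 0 *: \sum_p Q p i
      *: tnth E p)).
      rewrite e big1 // => p _; move: (vQ p); rewrite !mxE => vp.
      rewrite (_ : \sum_j _ = 0) ?scale0r // -[RHS]vp; apply: eq_bigr => i _.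
      by rewrite !mxE mulrC.
    by move=> i _; rewrite mxE.
  move=> /(biv_inj nf) [e0 e1 e2]; case/eqP: v0; apply/rowP => i; rewrite mxE.
  by case: i => [[|[|[|//]]] p]; [rewrite -[RHS]e0|rewrite -[RHS]e1|rewrite
    -[RHS]e2];
    congr (v 0 _); exact: val_inj.
have -> : \prod_i (y - x i) = \det (y%:M - N).
  rewrite -horner_char_poly cN horner_prod; apply: eq_bigr => i _.
  by rewrite !hornerE.
rewrite -det_weyl_matrix; apply: (mulIf Q0).
rewrite -det_mulmx mulmxBl NQ [RHS]mulrC -det_mulmx mulmxBr.
by rewrite -scalar_mxC.
Qed.

End TypeIRoots.

(** * The normalised principal triad *)

Section PrincipalTriad.

Variables (R : rcfType) (M : spacetime_point R).
Variables (l k : 'cV[R]_4) (m : 'cV[R[i]]_4).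
Hypothesis nf : null_frame M l k m.
Local Notation C := R[i].
Local Notation biv := (biv M l k m).
Variables (S : tensor4 C) (P0 P1 P2 P3 P4 delta beta : C).
Hypothesis SE : weyl_components S (frame_U M l m) (frame_W M l k m)
  (frame_V M k m) P0 P1 P2 P3 P4.
Hypothesis tI : type_I M S.
Local Notation I := (weyl_I P0 P1 P2 P3 P4).
Local Notation J := (weyl_J P0 P1 P2 P3 P4).
Hypotheses (delta2 : delta ^+ 2 = J ^+ 2 - I ^+ 3 / 27)
  (beta3 : beta ^+ 3 = J + delta) (beta0 : beta != 0).
Local Notation alpha := (weyl_root I beta).
Local Notation cA i := (weyl_A P0 P1 P2 P3 P4 (alpha i)).
Local Notation cB i := (weyl_B P1 P2 P3 P4 (alpha i)).
Local Notation cC i := (weyl_C P2 P3 P4 (alpha i)).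
Local Notation cD i := (weyl_D P0 P1 P2 P3 P4 (alpha i)).

(** The three distinct roots given by [type_I_roots] all occur among the values of [alpha], which
    therefore cannot repeat. *)
Lemma weyl_root_inj : injective alpha.
Proof.
have [x [xi xE]] := type_I_roots nf SE tI.
have xa i : x i \in codom alpha.
  have : \prod_j (x i - alpha j) = 0.
    rewrite (weyl_root_prod delta2 beta3 beta0) -xE.
    by apply/eqP/prodf_eq0; exists i => //; rewrite subrr.
  move/eqP/prodf_eq0 => [j _]; rewrite subr_eq0 => /eqP ->; exact: codom_f.
apply/injectiveP/(leq_size_uniq (s1 := codom x)); first exact/injectiveP.
  by move=> y /codomP[i ->].
by rewrite !size_codom.
Qed.

Lemma weyl_root_eq0 i : alpha i ^+ 3 - I * alpha i - 2 * J = 0.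
Proof.
rewrite -(weyl_root_prod delta2 beta3 beta0).
by apply/eqP/prodf_eq0; exists i => //; rewrite subrr.
Qed.

Lemma weyl_D_neq0 i : cD i != 0.
Proof.
rewrite mulf_neq0 ?invr_eq0 ?pnatr_eq0 // (weyl_root_deriv P0 P1 P2 P3 P4
  beta0).
rewrite oppr_eq0 mulf_neq0 // subr_eq0 (inj_eq weyl_root_inj);
  by case: i => [[|[|[|//]]] p].
Qed.

Local Notation triad r := (fun i : 'I_3 => biv (cA i / r i) (cB i / r i) (cC i
  / r i)).

Lemma triad_orthonormal (r : 'I_3 -> C) :
  (forall i, r i ^+ 2 = cD i * cC i) -> (forall i, cC i != 0) ->
  forall i j, cB i / r i * (cB j / r j)
    - (cA i / r i * (cC j / r j) + cC i / r i * (cA j / r j)) / 2 = (i == j)%:R.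
Proof.
move=> r2 C0 i j.
apply: (weyl_ABC_orthonormal i j weyl_root_inj weyl_root_eq0 r2) => p.
by rewrite -sqrf_eq0 r2 mulf_neq0 ?weyl_D_neq0.
Qed.

(** The principal square roots give a triad oriented up to the sign [e] of [orthonormal_cross];
    moving [e] into the third root corrects it. *)
Lemma oriented_triad_exists : (forall i, cC i != 0) ->
  exists r : 'I_3 -> C, (forall i, r i ^+ 2 = cD i * cC i) /\ oriented M (triad
    r).
Proof.
move=> C0; pose r0 i := sqrtC (cD i * cC i).
have r02 i : r0 i ^+ 2 = cD i * cC i by rewrite sqrtCK.
have [e [e2 [ex ey ez]]] := orthonormal_cross (triad_orthonormal r02 C0).
pose r (i : 'I_3) := if i == 1 + 1 then e * r0 i else r0 i.
have eV : e^-1 = e.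
  have e0 : e != 0 by rewrite -sqrf_eq0 e2 oner_eq0.
  by apply: (mulfI e0); rewrite mulfV // -expr2.
exists r; split.
  by move=> i; rewrite /r; case: ifP => _; rewrite ?exprMn ?e2 ?mul1r r02.
apply/oriented_biv.
have -> : r 0 = r0 0 by [].
have -> : r 1 = r0 1 by [].
have -> : r (1 + 1) = e * r0 (1 + 1) by [].
rewrite (rise_biv_mul nf) ex ey ez !invfM eV.
have half (u v : C) : u / 2 - v / 4 = (u - v / 2) / 2 by field.
rewrite half (triad_orthonormal r02 C0 0 1) mul0r raddf0 add0r -!riseZ !bivZ.
have h : sqrtC 2 / 4 = (sqrtC 2)^-1 / 2 :> C.
  have q : sqrtC 2 * sqrtC 2 = 2 :> C by rewrite -expr2 sqrtCK.
  apply: (mulIf (sqrtC2_neq0 R)).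
  by rewrite mulrAC q [RHS]mulrAC mulVf ?sqrtC2_neq0 // mul1r; field.
have hk (x y : C) : (sqrtC 2)^-1 / 2 * (- 2 * 'i * e * (x / y)) =
    - 'i / sqrtC 2 * (x * (e / y)).
  by move: 'i ((sqrtC 2)^-1) (y^-1) e {eV ex ey ez e2 r} => ? ? ? ?; field.
by rewrite h !hk.
Qed.

(* If [C_i = 0] then [r i = 0], and the [i]-th form is zero since [0^-1 = 0]. *)
Lemma oriented_triad_neq0 (r : 'I_3 -> C) :
  (forall i, r i ^+ 2 = cD i * cC i) -> oriented M (triad r) -> forall i, cC i
    != 0.
Proof.
move=> r2 /oriented_biv; set w := fun i => rise M (triad r i) => ww.
have r_eq0 i : (r i == 0) = (cC i == 0).
  by rewrite -sqrf_eq0 r2 mulf_eq0 (negPf (weyl_D_neq0 i)).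
have w0 i : cC i = 0 -> w i = 0.
  move=> /eqP; rewrite -r_eq0 => /eqP e.
  by rewrite /w e invr0 !mulr0 biv_eq0 riseE mulmx0.
have C0 i : w i = 0 -> cC i = 0.
  move=> wi; apply/eqP; have [//|ri] := boolP (cC i == 0).
  have : biv (cA i / r i) (cB i / r i) (cC i / r i) = biv 0 0 0.
    by apply: (@rise_inj _ M); rewrite biv_eq0 [rise M 0]riseE mulmx0.
  move=> /(biv_inj nf) [_ _ /eqP].
  by rewrite mulf_eq0 invr_eq0 r_eq0 orbb (negPf ri).
have sqr i : cC i != 0 -> w i *m w i = (2^-1)%:M.
  move=> ri; have ri0 : r i != 0 by rewrite r_eq0.
  rewrite /w (rise_biv_mul nf).
  have -> : cB i / r i * (cB i / r i) / 2 -
    (cA i / r i * (cC i / r i) + cC i / r i * (cA i / r i)) / 4 =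
    (cB i ^+ 2 - cA i * cC i) / (r i ^+ 2) / 2 by field.
  rewrite weyl_ABC_norm ?weyl_root_eq0 // -r2 mulfV ?expf_neq0 // mul1r.
  have z (a b : C) : a * b - b * a = 0 by rewrite mulrC subrr.
  by rewrite !z !mulr0 biv_eq0 riseE mulmx0 scaler0 addr0.
have k0 : - 'i / sqrtC 2 != 0 :> C.
  by rewrite mulf_neq0 ?invr_eq0 ?sqrtC2_neq0 // oppr_eq0 neq0Ci.
(* The third form is a nonzero multiple of the product of the first two, so it vanishes with either
   of them. Conversely, when it vanishes, a nonzero first form has an invertible operator that
   cancels. *)
have zeros : cC 0 = 0 \/ cC 1 = 0 -> cC (1 + 1) = 0.
  move=> c01; apply: C0; have /eqP : (- 'i / sqrtC 2) *: w (1 + 1) = 0.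
    by case: c01 => /w0 e; rewrite -[LHS]ww -/(w 0) -/(w 1) e ?mul0mx ?mulmx0.
  by rewrite scaler_eq0 (negPf k0) => /eqP.
have zeros' : cC (1 + 1) = 0 -> cC 0 = 0 \/ cC 1 = 0.
  move=> /w0 w2; have [|c0] := eqVneq (cC 0) 0; [by left|right].
  have w01 : w 0 *m w 1 = 0 by apply: etrans ww _; rewrite -/(w (1 + 1)) w2
    scaler0.
  apply: C0; have : (2^-1)%:M *m w 1 = 0 by rewrite -(sqr 0 c0) -mulmxA w01
    mulmx0.
  by rewrite mul_scalar_mx => /eqP; rewrite scaler_eq0 invr_eq0 pnatr_eq0 =>
    /eqP.
have contra i j : alpha i != alpha j -> cC i = 0 -> cC j = 0 -> False.
  move=> ij ci cj; apply: (weyl_C_eq0 ij ci cj) weyl_D_neq0.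
  exact: (weyl_root_prod delta2 beta3 beta0).
(* Any vanishing coefficient would thus force a second one to vanish, which [weyl_C_eq0]
   excludes. *)
have c2 : cC (1 + 1) != 0.
  apply/eqP => c2; case: (zeros' c2) => c.
    by apply: (contra 0 (1 + 1)) => //; rewrite (inj_eq weyl_root_inj).
  by apply: (contra 1 (1 + 1)) => //; rewrite (inj_eq weyl_root_inj).
case=> [[|[|[|//]]] p].
- rewrite (_ : Ordinal p = 0); last exact: val_inj.
  by apply: contraNneq c2 => c; apply/eqP/zeros; left.
- rewrite (_ : Ordinal p = 1); last exact: val_inj.
  by apply: contraNneq c2 => c; apply/eqP/zeros; right.
- by rewrite (_ : Ordinal p = 1 + 1) //; exact: val_inj.
Qed.


Lemma triad_principal_forms (r : 'I_3 -> C) :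
  (forall i, r i ^+ 2 = cD i * cC i) -> (forall i, cC i != 0) ->
  principal_forms M S alpha (triad r).
Proof.
move=> r2 C0; split=> [i|i|i j].
- exact: (biv_self_dual nf).
- rewrite (tensor_app_biv nf SE) bivZ.
  have [e1 e2 e3] := weyl_ABC_eigen (weyl_root_eq0 i).
  by rewrite !mulrA -!mulrBl -!mulrDl e1 e2 e3.
- rewrite (form_dot_biv nf) -(triad_orthonormal r2 C0 i j).
  by rewrite opprB.
Qed.

(** The squared modulus of [r i] is the product of the moduli of [D_i] and [C_i], whatever the
    choice of root. *)
Lemma triad_bE (r : 'I_3 -> C) : (forall i, r i ^+ 2 = cD i * cC i) ->
  (forall i, cC i != 0) ->
  triad_b (fun i => cC i / r i) = \sum_i `|cC i| / `|cD i|.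
Proof.
move=> r2 C0; apply: eq_bigr => i _.
rewrite normf_div expr_div_n -[`|r i| ^+ 2]normrX r2 normrM expr2 invfM.
by rewrite mulrACA mulfV ?mulr1 // normr_eq0.
Qed.

Lemma triad_cE (r : 'I_3 -> C) : (forall i, r i ^+ 2 = cD i * cC i) ->
  triad_c (fun i => cB i / r i) (fun i => cC i / r i) =
  - \sum_i (cB i)^* * cC i / (`|cD i| * `|cC i|).
Proof.
move=> r2; congr (- _); apply: eq_bigr => i _.
rewrite -normrM -r2 normrX normCK invfM.
have -> : (cB i / r i)^* = (cB i)^* / (r i)^* by rewrite rmorphM fmorphV.
by rewrite mulrACA [_^-1 * (r i)^-1]mulrC.
Qed.

End PrincipalTriad.

Lemma biv_div (R : rcfType) (M : spacetime_point R) l k m (a b c r : R[i]) :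
  r^-1 *: biv M l k m a b c = biv M l k m (a / r) (b / r) (c / r).
Proof. by rewrite bivZ !(mulrC r^-1). Qed.

(** The roots enter as [delta] and [r], constrained through their squares, so every admissible
    choice of signs is covered. The first conjunct provides an orienting choice when all the
    denominators are nonzero. *)
Theorem theorem3 (R : realType) (M : spacetime_point R) (T : tensor4 R)
    (l k : 'cV[R]_4) (m : 'cV[R[i]]_4)
    (Psi0 Psi1 Psi2 Psi3 Psi4 delta beta : R[i])
    (W := frame_W M l k m) (U := frame_U M l m) (V := frame_V M k m)
    (I := weyl_I Psi0 Psi1 Psi2 Psi3 Psi4)
    (J := weyl_J Psi0 Psi1 Psi2 Psi3 Psi4)
    (alpha := weyl_root I beta)
    (A := fun i : 'I_3 => Psi0 * Psi4 + Psi2 ^+ 2 - 2 * Psi1 * Psi3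
                          + alpha i * Psi2 + (alpha i ^+ 2 - I))
    (B := fun i : 'I_3 => Psi1 * Psi4 - Psi2 * Psi3 + Psi3 * alpha i)
    (C := fun i : 'I_3 => 2 * Psi2 * Psi4 - 2 * Psi3 ^+ 2 + alpha i * Psi4)
    (D := fun i : 'I_3 => 2^-1 * (I - 3 * alpha i ^+ 2))
    (Wp := fun (r : 'I_3 -> R[i]) (i : 'I_3) =>
             (r i)^-1 *: (A i *: U + B i *: W + C i *: V))
    (b := \sum_(i < 3) `|C i| / `|D i|)
    (c := - \sum_(i < 3) (B i)^* * C i / (`|D i| * `|C i|))
    (a := 2 + c * c^* / b) :
  weyl_tensor M T ->
  type_I M (self_dual_weyl M T) ->
  null_frame M l k m ->
  weyl_components (self_dual_weyl M T) U W V Psi0 Psi1 Psi2 Psi3 Psi4 ->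
  ~ (Psi1 = 0 /\ Psi3 = 0) ->
  delta ^+ 2 = J ^+ 2 - I ^+ 3 / 27 ->
  beta ^+ 3 = J + delta ->
  beta != 0 ->
  ((forall i, C i != 0) ->
     exists r : 'I_3 -> R[i],
       (forall i, r i ^+ 2 = D i * C i) /\ oriented M (Wp r))
  /\
  (forall r : 'I_3 -> R[i],
     (forall i, r i ^+ 2 = D i * C i) -> oriented M (Wp r) ->
     principal_forms M (self_dual_weyl M T) alpha (Wp r) /\
     exists e : 'I_4 -> 'cV[R]_4,
       [/\ weyl_canonical_frame M (Wp r) e,
           map_mx (real_complex R) (e ord0) =
             (2 * sqrtC b)^-1 *:
               (a *: map_mx (real_complex R) l + b *: map_mx (real_complex R) k
                + c *: m + c^* *: map_mx Num.conj m)
         & forall i : 'I_3,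
             map_mx (real_complex R) (e (lift ord0 i)) =
               sqrtC 2 *: form_app M (Wp r i) (map_mx (real_complex R) (e ord0))]).
Proof.
move=> _ tI nf SE _ d2 b3 b0.
have WpE r : Wp r = fun i => biv M l k m (A i / r i) (B i / r i) (C i / r i).
  apply: boolp.funext => i; apply: etrans (biv_div M l k m _ _ _ _).
  by rewrite bivE.
split.
  move=> C0; have [r [r2 ro]] := oriented_triad_exists nf SE tI d2 b3 b0 C0.
  by exists r; split=> //; rewrite WpE.
move=> r r2; rewrite WpE => ro.
(* Orientation already excludes a vanishing [C i], so the quotients below never use the default
   value of division by zero. *)
have C0 := oriented_triad_neq0 nf SE tI d2 b3 b0 r2 ro.
split; first exact: (triad_principal_forms nf SE tI d2 b3 b0 r2 C0).
have := triad_weyl_canonical_frame nf (triad_orthonormal nf SE tI d2 b3 b0 r2 C0) ro.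
rewrite /triad_a (triad_bE r2 C0) (triad_cE r2) -/b -/c -/a.
by [].
Qed.
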